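(* For every integer $p\ge 1$, $$\begin{aligned} &\frac32\sum_{n=1}^\infty \frac{L_n^2(1)}{n^{p+1}}(-1)^{n-1}-\left(1+(-1)^{p-1}\right)\sum_{n=1}^\infty\frac{H_n^2}{n^{p+1}}(-1)^{n-1}\\ &=\ln 2\left(\zeta^\star(\overline{p+1},\overline 1)-\zeta^\star(\overline{p+1},1)\right)+\frac12\zeta(2)\left\{\zeta(p+1)+\bar\zeta(p+1)\right\}\\ &\quad+\frac12\zeta^\star(\overline{p+1},2)-\sum_{j=2}^p\left(1-(-1)^{j-1}\right)\zeta^\star(\overline j,1)\,\zeta(p+2-j)\\ &\quad-\sum_{j=2}^{p+1}\zeta^\star(j,\overline 1)\,\bar\zeta(p+2-j)+\left(p+2+(-1)^{p-1}\right)\zeta^\star(\overline{p+2},1)-\zeta^\star(p+2,\overline 1)\\ &\quad-\sum_{i=1}^{p-1}(-1)^{i-1}\zeta(p+1-i)\,\bar\zeta(i+2)-(p+1)\zeta^\star(\overline{p+2},\overline 1)+\ln 2\,\zeta^\star(\overline{p+1},\overline 1). \end{aligned}$$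
   Context: For integers $n,k\ge1$: $H_n=\sum_{j=1}^n \frac1j$, $L_n(k)=\sum_{j=1}^n \frac{(-1)^{j-1}}{j^k}$. $\zeta$ is the Riemann zeta function and $\bar\zeta(s)=\sum_{n=1}^\infty \frac{(-1)^{n-1}}{n^s}$ for $\Re(s)\ge 1$ (so $\bar\zeta(1)=\ln 2$). Multiple zeta-star values: for positive integers $s_1,\dots,s_k$, each possibly carrying a bar, $\zeta^\star(s_1,\dots,s_k)=\sum_{n_1\ge n_2\ge\cdots\ge n_k\ge1}\prod_{j=1}^k \frac{\varepsilon_j^{n_j}}{n_j^{s_j}}$, where $\varepsilon_j=-1$ if $s_j$ is barred and $\varepsilon_j=1$ otherwise; the series is read as the sum over $n_1$ of the finite inner sums. For instance $\zeta^\star(\bar q,p)=\sum_{m\ge1}\frac{(-1)^m}{m^q}\sum_{n=1}^m\frac1{n^p}$. Empty sums are zero. *)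

(* Defs.v *)
From Stdlib Require Import Reals List.
From Coquelicot Require Import Coquelicot.
Open Scope R_scope.

(* Sum over n >= 1; [Series] starts at index 0. *)
Definition Series1 (f : nat -> R) : R := Series (fun n => f (S n)).

Definition H (n : nat) : R := sum_n_m (fun j => / INR j) 1 n.

Definition L (n k : nat) : R :=
  sum_n_m (fun j => (-1) ^ (j - 1) / INR j ^ k) 1 n.

(* Riemann zeta at integer arguments; the series represents it for s >= 2. *)
Definition zeta (s : nat) : R := Series1 (fun n => / INR n ^ s).

(* Alternating zeta at integer arguments s >= 1. *)
Definition zeta_bar (s : nat) : R :=
  Series1 (fun n => (-1) ^ (n - 1) / INR n ^ s).

(* Arguments of a multiple zeta-star value: s or s with a bar. *)
Inductive zindex : Set :=
| Plain (s : nat)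
| Bar (s : nat).

(* epsilon^n / n^s, with epsilon = -1 for a barred index. *)
Definition zterm (i : zindex) (n : nat) : R :=
  match i with
  | Plain s => 1 / INR n ^ s
  | Bar s => (-1) ^ n / INR n ^ s
  end.

(* Sum over N >= n_1 >= ... >= n_k >= 1. *)
Fixpoint zeta_star_upto (l : list zindex) (N : nat) : R :=
  match l with
  | nil => 1
  | i :: l' => sum_n_m (fun n => zterm i n * zeta_star_upto l' n) 1 N
  end.

(* The series over n_1 of the finite inner sums. *)
Definition zeta_star (l : list zindex) : R :=
  match l with
  | nil => 1
  | i :: l' => Series1 (fun n => zterm i n * zeta_star_upto l' n)
  end.

(* Main.v *)
(* For u = m and v = n or v = - n, the geometric sum over j of
   u^(-j) v^(-(q+1-j)) equals
     u^(-q) (1/(v-u) - 1/v) - v^(-q) (1/u - 1/(u-v)).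
   Multiplying by a_m b_n and summing turns the convolution over j of the
   Dirichlet series of a and b into two single series, weighted by the kernel
   sums over n of b_n (1/(v-u) - 1/v) and over m of a_m (1/u - 1/(u-v)).
   - For a = L and b_n = (-1)^(n-1) the second kernel sum is
     ln 2 (L_n + H_n) - L_n(2) - (L_n^2 - H_n(2))/2, so L_n^2 occurs with total
     coefficient 3/2.
   - For a_m = (-1)^(m-1) H_m and b = 1, the two signs of v give kernel sums
     whose difference is elementary, and H_n^2 occurs with coefficient
     1 + (-1)^(p-1).
   - The remaining double sums are matched by a_m = (-1)^(m-1), b = 1, v = - n
     and by the relation between zeta(2) and its alternating analogue. *)
Require Import Defs.
From Stdlib Require Import Reals List Lra Lia.
From Coquelicot Require Import Coquelicot.
Import ListNotations.
Open Scope R_scope.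


(** In the full geometric sum over 1 <= j <= q the end terms j = q and j = 1 are u^(-q)/v and
    v^(-q)/u. Moved to the other side, they become the corrections -1/v and 1/u of the kernels. The
    products that remain only involve exponents at least 2, and the corrected kernels are summable
    even for b = 1 or a = [L], where 1/(v-u) or 1/(u-v) alone is not. The interchange of summations
    never meets an infinite double sum: n is cut at N, the finite sum over n is exchanged with the
    series over m, and N tends to infinity by dominated convergence in m. This asks for a bound C
    H_m, uniform in N, on the truncated kernel sums over n; the series of H_m^2/m^2 is then the
    common majorant. The kernel sums over m are found by induction on n, the passage from n to n + 1
    being an Abel summation. For [L] it yields the difference of consecutive kernel sums; for
    (-1)^(m-1) H_m, because the sign flips, it yields their sum. Since / 0 = 0, diagonal terms lose
    their singular part and reappear as explicit corrections. *)

(** * Sums from index 1 and dominated convergence for series *)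

Fixpoint psum (f : nat -> R) (N : nat) : R :=
  match N with
  | O => 0
  | S N' => psum f N' + f (S N')
  end.

(** Convergence is part of the predicate, whereas [Series1] returns a value even for a divergent
    series. Only convergence in the given order is meant, since several kernel sums converge
    conditionally. *)
Definition is_sum (f : nat -> R) (l : R) : Prop := is_lim_seq (psum f) l.

Lemma sum_n_m_psum f N : sum_n_m f 1 N = psum f N.
Proof.
  induction N as [|N IH].
  - now rewrite sum_n_m_zero by lia.
  - rewrite sum_n_Sm by lia. now rewrite IH.
Qed.

Lemma psum_ext f g N :
  (forall n, (1 <= n <= N)%nat -> f n = g n) -> psum f N = psum g N.
Proof.
  induction N as [|N IH]; intros E; simpl; [easy|].
  rewrite IH, E by (intros; try apply E; lia). easy.
Qed.

Lemma psum_plus f g N : psum (fun n => f n + g n) N = psum f N + psum g N.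
Proof. induction N; simpl; lra. Qed.

Lemma psum_scal c f N : psum (fun n => c * f n) N = c * psum f N.
Proof. induction N; simpl; lra. Qed.

Lemma psum_minus f g N : psum (fun n => f n - g n) N = psum f N - psum g N.
Proof. induction N; simpl; lra. Qed.

Lemma psum_const c N : psum (fun _ => c) N = INR N * c.
Proof. induction N; [simpl; lra|]. rewrite S_INR; simpl; lra. Qed.

Lemma psum_first f N : psum f (S N) = f 1%nat + psum (fun n => f (S n)) N.
Proof.
  induction N as [|N IH]; [simpl; lra|].
  change (psum f (S N) + f (S (S N)) =
    f 1%nat + (psum (fun n => f (S n)) N + f (S (S N)))).
  rewrite IH. lra.
Qed.

Lemma psum_single c n N : (1 <= n)%nat ->
  psum (fun m => if Nat.eqb m n then c else 0) N = if Nat.leb n N then c else 0.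
Proof.
  intros Hn; induction N as [|N IH]; cbn [psum].
  - now destruct n; [lia|].
  - rewrite IH.
    destruct (Nat.leb_spec n N), (Nat.eqb_spec (S N) n), (Nat.leb_spec n (S N));
      lia || lra.
Qed.

Lemma is_sum_ext f g l :
  (forall n, (1 <= n)%nat -> f n = g n) -> is_sum f l -> is_sum g l.
Proof.
  intros E; apply is_lim_seq_ext; intros N. apply psum_ext; intros; apply E; lia.
Qed.

Lemma is_sum_unique f l l' : is_sum f l -> is_sum f l' -> l = l'.
Proof.
  intros A B. apply is_lim_seq_unique in A, B. rewrite A in B. now injection B.
Qed.

Lemma is_sum_plus f g l l' :
  is_sum f l -> is_sum g l' -> is_sum (fun n => f n + g n) (l + l').
Proof.
  intros A B. eapply is_lim_seq_ext; [intros N; symmetry; apply psum_plus|].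
  now apply is_lim_seq_plus'.
Qed.

Lemma is_sum_scal c f l : is_sum f l -> is_sum (fun n => c * f n) (c * l).
Proof.
  intros A. eapply is_lim_seq_ext; [intros N; symmetry; apply psum_scal|].
  apply (is_lim_seq_scal_l _ c l A).
Qed.

Lemma is_sum_minus f g l l' :
  is_sum f l -> is_sum g l' -> is_sum (fun n => f n - g n) (l - l').
Proof.
  intros A B. eapply is_lim_seq_ext; [intros N; symmetry; apply psum_minus|].
  now apply is_lim_seq_minus'.
Qed.

Lemma is_sum_psum (f : nat -> nat -> R) l N :
  (forall i, (1 <= i <= N)%nat -> is_sum (f i) (l i)) ->
  is_sum (fun m => psum (fun i => f i m) N) (psum l N).
Proof.
  induction N as [|N IH]; intros Hf; simpl.
  - eapply is_lim_seq_ext; [|apply is_lim_seq_const].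
    intros n; rewrite psum_const; simpl; lra.
  - apply is_sum_plus; [apply IH; intros|]; apply Hf; lia.
Qed.

Lemma is_sum_single c n : (1 <= n)%nat ->
  is_sum (fun m => if Nat.eqb m n then c else 0) c.
Proof.
  intros Hn. eapply is_lim_seq_ext_loc; [|apply is_lim_seq_const].
  exists n; intros N HN. rewrite psum_single by easy.
  destruct (Nat.leb_spec n N); lia || easy.
Qed.

Lemma is_lim_seq_psum (f : nat -> nat -> R) (l : nat -> R) M :
  (forall m, (1 <= m <= M)%nat -> is_lim_seq (fun N => f N m) (l m)) ->
  is_lim_seq (fun N => psum (f N) M) (psum l M).
Proof.
  induction M as [|M IH]; intros Hf; simpl; [apply is_lim_seq_const|].
  apply is_lim_seq_plus'; [apply IH; intros|]; apply Hf; lia.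
Qed.

Lemma psum_sum_n f N : psum f (S N) = sum_n (fun n => f (S n)) N.
Proof.
  unfold sum_n. rewrite sum_n_m_S. now rewrite <- sum_n_m_psum.
Qed.

Lemma Series1_is_sum f l : is_sum f l -> Series1 f = l.
Proof.
  intros A. apply is_series_unique.
  assert (B : is_lim_seq (sum_n (fun n => f (S n))) l).
  { apply (is_lim_seq_ext (fun N => psum f (S N))).
    - intros N; apply psum_sum_n.
    - now apply is_lim_seq_incr_1 in A. }
  exact B.
Qed.

(** The triangle inequality bounds each block of [f] beyond [M] by the same block of [g]; the block
    length then tends to infinity. *)
Lemma is_sum_tail_bound f g s G M :
  (forall m, (1 <= m)%nat -> Rabs (f m) <= g m) ->
  is_sum f s -> is_sum g G -> Rabs (s - psum f M) <= G - psum g M.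
Proof.
  intros B Hf Hg.
  assert (D : forall d, Rabs (psum f (d + M) - psum f M)
                        <= psum g (d + M) - psum g M).
  { induction d as [|d IH]; simpl.
    - rewrite !Rminus_diag, Rabs_R0; lra.
    - specialize (B (S (d + M)) ltac:(lia)).
      replace (psum f (d + M) + f (S (d + M)) - psum f M)
        with ((psum f (d + M) - psum f M) + f (S (d + M))) by ring.
      eapply Rle_trans; [apply Rabs_triang|lra]. }
  assert (Hf' : is_lim_seq (fun N => Rabs (psum f N - psum f M))
                           (Rabs (s - psum f M))).
  { apply (is_lim_seq_abs _ (s - psum f M)).
    apply is_lim_seq_minus'; [exact Hf|apply is_lim_seq_const]. }
  assert (Hg' : is_lim_seq (fun N => psum g N - psum g M) (G - psum g M)).
  { apply is_lim_seq_minus'; [exact Hg|apply is_lim_seq_const]. }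
  apply (is_lim_seq_le_loc _ _ (Rabs (s - psum f M)) (G - psum g M)
    ) with (2 := Hf') (3 := Hg').
  exists M; intros n Hn. replace n with ((n - M) + M)%nat by lia. apply D.
Qed.

(** Tannery's theorem. Beyond a suitable [M] the tail of [g] controls the tails of all [f N] and of
    [l] at once, and the finite head converges term by term. *)
Lemma is_sum_dominated_convergence (f : nat -> nat -> R) (g l s : nat -> R) (G S : R) :
  (forall N m, (1 <= m)%nat -> Rabs (f N m) <= g m) ->
  (forall m, (1 <= m)%nat -> is_lim_seq (fun N => f N m) (l m)) ->
  is_sum g G -> (forall N, is_sum (f N) (s N)) -> is_sum l S ->
  is_lim_seq s S.
Proof.
  intros B Hl Hg Hf HS.
  assert (Bl : forall m, (1 <= m)%nat -> Rabs (l m) <= g m).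
  { intros m Hm.
    apply (is_lim_seq_le (fun N => Rabs (f N m)) (fun _ => g m)
             (Rabs (l m)) (g m)).
    - intros; now apply B.
    - apply (is_lim_seq_abs _ (l m)). now apply Hl.
    - apply is_lim_seq_const. }
  apply is_lim_seq_spec; intros eps; simpl.
  assert (Heps : 0 < eps / 4) by (destruct eps; simpl; lra).
  destruct (proj2 (is_lim_seq_spec _ _) Hg (mkposreal _ Heps)) as [M HM].
  specialize (HM M (le_n M)); simpl in HM.
  apply Rabs_def2 in HM.
  assert (HP : is_lim_seq (fun N => psum (f N) M) (psum l M)).
  { apply is_lim_seq_psum; intros m Hm; apply Hl; lia. }
  destruct (proj2 (is_lim_seq_spec _ _) HP (mkposreal _ Heps)) as [N0 HN].
  exists N0; intros N HN0. specialize (HN N HN0); simpl in HN.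
  pose proof (is_sum_tail_bound _ _ _ _ M (B N) (Hf N) Hg) as T1.
  pose proof (is_sum_tail_bound _ _ _ _ M Bl HS Hg) as T2.
  apply Rabs_def2 in HN. apply Rabs_le_between in T1, T2.
  apply Rabs_def1; lra.
Qed.

(** * Harmonic numbers *)

Lemma H_S n : H (S n) = H n + / INR (S n).
Proof. unfold H. now rewrite !sum_n_m_psum. Qed.

Lemma H_0 : H 0 = 0.
Proof. unfold H. now rewrite sum_n_m_psum. Qed.

Lemma L_0 k : L 0 k = 0.
Proof. unfold L. now rewrite sum_n_m_psum. Qed.

Lemma L_S n k : L (S n) k = L n k + (-1) ^ n / INR (S n) ^ k.
Proof.
  unfold L. rewrite !sum_n_m_psum. cbn [psum]. now replace (S n - 1)%nat with n by lia.
Qed.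

Lemma INR_S_pos n : 0 < INR (S n).
Proof. apply lt_0_INR; lia. Qed.

Lemma INR_gt_0 n : (1 <= n)%nat -> 0 < INR n.
Proof. intros; apply lt_0_INR; lia. Qed.

Lemma H_le_add a b : H a <= H (b + a).
Proof.
  induction b as [|b IH]; simpl; [lra|]. rewrite H_S.
  pose proof (Rinv_0_lt_compat _ (INR_S_pos (b + a))). lra.
Qed.

Lemma H_le a b : (a <= b)%nat -> H a <= H b.
Proof. intros Hab. replace b with ((b - a) + a)%nat by lia. apply H_le_add. Qed.

Lemma H_nonneg n : 0 <= H n.
Proof. rewrite <- H_0. apply H_le; lia. Qed.

Lemma H_1 : H 1 = 1.
Proof. rewrite H_S, H_0; simpl; lra. Qed.

Lemma H_ge_1 n : (1 <= n)%nat -> 1 <= H n.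
Proof.
  intros Hn. rewrite <- H_1. now apply H_le.
Qed.

Lemma H_subadditive a b : H (b + a) <= H a + H b.
Proof.
  induction b as [|b IH]; simpl; [rewrite H_0; lra|]. rewrite !H_S.
  enough (/ INR (S (b + a)) <= / INR (S b)) by lra.
  apply Rinv_le_contravar; [apply INR_S_pos|apply le_INR; lia].
Qed.

Lemma H_shift_bound a b : H (b + a) - H a <= INR b / INR (S a).
Proof.
  induction b as [|b IH]; [simpl; lra|]. cbn [Nat.add]. rewrite H_S, (S_INR b).
  assert (/ INR (S (b + a)) <= / INR (S a)).
  { apply Rinv_le_contravar; [apply INR_S_pos|apply le_INR; lia]. }
  unfold Rdiv in *. lra.
Qed.

Lemma is_lim_seq_inv_INR_S : is_lim_seq (fun n => / INR (S n)) 0.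
Proof.
  apply (is_lim_seq_incr_1 (fun n => / INR n)).
  apply (is_lim_seq_inv _ p_infty); [apply is_lim_seq_INR|easy].
Qed.

Lemma H_shift_lim b : is_lim_seq (fun a => H (b + a) - H a) 0.
Proof.
  apply (is_lim_seq_le_le (fun _ => 0) _ (fun a => INR b / INR (S a))).
  - intros a; split; [pose proof (H_le_add a b); lra|apply H_shift_bound].
  - apply is_lim_seq_const.
  - replace (Finite 0) with (Rbar_mult (INR b) 0)
      by (simpl; now rewrite Rmult_0_r).
    apply is_lim_seq_scal_l, is_lim_seq_inv_INR_S.
Qed.

(* [(H_n^2 + 2 H_n + 3) / n] has decrements at least [H_n^2 / (2 n^2)]. *)
Lemma psum_H_sq_bound N :
  psum (fun n => H n ^ 2 / INR n ^ 2) N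
  <= 12 - 2 * (H (S N) ^ 2 + 2 * H (S N) + 3) / INR (S N).
Proof.
  induction N as [|N IH].
  (* Equality at [N = 0]: 2 (1 + 2 + 3) / 1 = 12 is the origin of the constant. *)
  - rewrite H_1; right; simpl; field.
  - cbn [psum]. rewrite (H_S (S N)). set (h := H (S N)) in *.
    assert (0 <= h) by apply H_nonneg.
    rewrite (S_INR (S N)).
    assert (1 <= INR (S N)) by (apply (le_INR 1); lia).
    set (x := INR (S N)) in *.
    enough (0 <= 2 * (h ^ 2 + 2 * h + 3) / x - h ^ 2 / x ^ 2
      - 2 * ((h + / (x + 1)) ^ 2 + 2 * (h + / (x + 1)) + 3) / (x + 1)) by lra.
    (* Over the common denominator only -2 x^2 is negative, as [x >= 1], and 2 x (x + 1) (x + 3)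
       absorbs it. *)
    replace (2 * (h ^ 2 + 2 * h + 3) / x - h ^ 2 / x ^ 2
      - 2 * ((h + / (x + 1)) ^ 2 + 2 * (h + / (x + 1)) + 3) / (x + 1))
    with ((h ^ 2 * (x - 1) * (x + 1) ^ 2
       + 2 * x * (x + 1) * (x * 1 + 3)
       + 4 * h * x * (x + 1)  - 2 * x ^ 2) / (x ^ 2 * (x + 1) ^ 3)).
    2: { field. lra. }
    apply Rdiv_le_0_compat.
    + assert (0 <= h ^ 2 * (x - 1) * (x + 1) ^ 2).
      { repeat apply Rmult_le_pos; try lra; apply pow2_ge_0. }
      assert (0 <= h * x * (x + 1)) by (repeat apply Rmult_le_pos; lra).
      nra.
    + apply Rmult_lt_0_compat; apply pow_lt; lra.
Qed.

(** The universal majorant: in every absolutely convergent series below, the terms are O(H_n^2 /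
    n^2). *)
Lemma is_sum_H_sq : exists G, is_sum (fun n => H n ^ 2 / INR n ^ 2) G.
Proof.
  destruct (ex_finite_lim_seq_incr (psum (fun n => H n ^ 2 / INR n ^ 2)) 12)
    as [G HG]; [| |now exists G].
  - intros n; cbn [psum]. enough (0 <= H (S n) ^ 2 / INR (S n) ^ 2) by lra.
    apply Rdiv_le_0_compat; [apply pow2_ge_0|apply pow_lt, INR_S_pos].
  - intros n. eapply Rle_trans; [apply psum_H_sq_bound|].
    enough (0 <= 2 * (H (S n) ^ 2 + 2 * H (S n) + 3) / INR (S n)) by lra.
    pose proof (H_nonneg (S n)).
    apply Rdiv_le_0_compat; [nra|apply INR_S_pos].
Qed.

Lemma is_sum_dominated f C :
  (forall n, (1 <= n)%nat -> Rabs (f n) <= C * (H n ^ 2 / INR n ^ 2)) ->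
  is_sum f (Series1 f).
Proof.
  intros B. destruct is_sum_H_sq as [G HG].
  assert (E : ex_series (fun n => f (S n))).
  { apply (@ex_series_le R_AbsRing R_CompleteNormedModule _
             (fun n => C * (H (S n) ^ 2 / INR (S n) ^ 2))).
    - intros n; apply B; lia.
    - exists (C * G).
      pose proof (is_sum_scal C _ _ HG) as A.
      assert (A' : is_lim_seq
        (sum_n (fun n => C * (H (S n) ^ 2 / INR (S n) ^ 2))) (C * G)).
      { eapply is_lim_seq_ext;
          [intros N; apply (psum_sum_n (fun n => C * (H n ^ 2 / INR n ^ 2)))|].
        now apply is_lim_seq_incr_1 in A. }
      exact A'. }
  apply Series_correct in E.
  assert (E' : is_lim_seq (sum_n (fun n => f (S n))) (Series1 f)) by exact E.
  apply is_lim_seq_incr_1.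
  eapply is_lim_seq_ext; [intros N; symmetry; apply psum_sum_n|exact E'].
Qed.

Lemma Rdiv_pow_le n i : (1 <= n)%nat -> (2 <= i)%nat ->
  / INR n ^ i <= / INR n ^ 2.
Proof.
  intros Hn Hi. apply Rinv_le_contravar; [apply pow_lt, INR_gt_0, Hn|].
  apply Rle_pow; [now apply (le_INR 1)|easy].
Qed.

Lemma is_sum_div_pow a C i : (2 <= i)%nat ->
  (forall n, (1 <= n)%nat -> Rabs (a n) <= C * H n ^ 2) ->
  is_sum (fun n => a n / INR n ^ i) (Series1 (fun n => a n / INR n ^ i)).
Proof.
  intros Hi B. apply (is_sum_dominated _ C). intros n Hn.
  unfold Rdiv. rewrite Rabs_mult, <- Rmult_assoc.
  rewrite (Rabs_pos_eq (/ _)) by (left; apply Rinv_0_lt_compat, pow_lt, INR_gt_0, Hn).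
  apply Rmult_le_compat; auto using Rabs_pos, Rdiv_pow_le.
  left; apply Rinv_0_lt_compat, pow_lt, INR_gt_0, Hn.
Qed.

Lemma INR_minus_neq m n : m <> n -> INR m - INR n <> 0.
Proof. intros Hmn E. apply Hmn, INR_eq. lra. Qed.

(* Truncated subtraction makes the formula valid both for [N < m] and for
   [m <= N]; the term [n = m] is [x / 0 = 0]. *)
Lemma psum_shift_down x m N : x = 1 \/ x = -1 -> (1 <= m)%nat ->
  psum (fun n => x ^ S n / (INR n - INR m)) N =
  x ^ m * (psum (fun n => x ^ S n / INR n) (N - m)
           + psum (fun n => x ^ S n / INR n) (m - 1 - N)
           - psum (fun n => x ^ S n / INR n) (m - 1)).
Proof.
  intros Hx Hm. assert (X : x * x = 1) by (destruct Hx; subst; lra).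
  assert (X2 : forall d, x ^ d * x ^ d = 1).
  { intros d. rewrite <- Rpow_mult_distr, X. apply pow1. }
  induction N as [|N IH].
  - rewrite Nat.sub_0_r. simpl. ring.
  - cbn [psum]. rewrite IH.
    destruct (Nat.lt_trichotomy (S N) m) as [C | [C | C]].
    + assert (exists d, m = S N + S d)%nat as [d ->] by (exists (m - S N - 1)%nat; lia).
      replace (N - (S N + S d))%nat with 0%nat by lia.
      replace (S N - (S N + S d))%nat with 0%nat by lia.
      replace (S N + S d - 1 - N)%nat with (S d) by lia.
      replace (S N + S d - 1 - S N)%nat with d by lia.
      replace (INR (S N) - INR (S N + S d)) with (- INR (S d))
        by (rewrite (plus_INR (S N)); ring).
      cbn [psum]. pose proof (INR_S_pos d) as Hd.
      enough (E : x ^ S (S N) / - INR (S d) =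
                  - (x ^ (S N + S d) * (x ^ S (S d) / INR (S d))))
        by (rewrite E; ring).
      replace (x ^ (S N + S d) * (x ^ S (S d) / INR (S d)))
        with (x ^ S (S N) * (x ^ S d * x ^ S d) / INR (S d)).
      2: { unfold Rdiv. rewrite <- !Rmult_assoc, <- !pow_add.
           apply (f_equal (fun k => x ^ k * / INR (S d))). lia. }
      rewrite X2. field; lra.
    + subst m. rewrite Rminus_diag. unfold Rdiv at 4. rewrite Rinv_0.
      replace (N - S N)%nat with 0%nat by lia.
      replace (S N - S N)%nat with 0%nat by lia.
      replace (S N - 1 - N)%nat with 0%nat by lia.
      replace (S N - 1 - S N)%nat with 0%nat by lia. ring.
    + assert (exists d, S N = m + S d)%nat as [d E] by (exists (S N - m - 1)%nat; lia).
      replace (N - m)%nat with d by lia.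
      replace (S N - m)%nat with (S d) by lia.
      replace (m - 1 - N)%nat with 0%nat by lia.
      replace (m - 1 - S N)%nat with 0%nat by lia.
      rewrite E.
      replace (INR (m + S d) - INR m) with (INR (S d))
        by (rewrite plus_INR; ring).
      cbn [psum]. pose proof (INR_S_pos d) as Hd.
      replace (x ^ S (m + S d)) with (x ^ m * x ^ S (S d))
        by (rewrite <- pow_add; f_equal; lia).
      field; lra.
Qed.

(** As x^2 = 1, the factor x^(n+1) equals x^m x^(n+m+1), so the sum is x^m times the block of
    indices from m + 1 to N + m. *)
Lemma psum_shift_up x m N : x = 1 \/ x = -1 ->
  psum (fun n => x ^ S n / (INR n + INR m)) N =
  x ^ m * (psum (fun n => x ^ S n / INR n) (N + m)
           - psum (fun n => x ^ S n / INR n) m).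
Proof.
  intros Hx. assert (X : x * x = 1) by (destruct Hx; subst; lra).
  assert (X2 : x ^ m * x ^ m = 1).
  { rewrite <- Rpow_mult_distr, X. apply pow1. }
  induction N as [|N IH]; [simpl; ring|].
  cbn [psum Nat.add]. rewrite IH, <- plus_INR. cbn [Nat.add].
  enough (E : x ^ S (S N) / INR (S (N + m)) =
              x ^ m * (x ^ S (S (N + m)) / INR (S (N + m))))
    by (rewrite E; ring).
  pose proof (INR_S_pos (N + m)) as Hd.
  replace (x ^ m * (x ^ S (S (N + m)) / INR (S (N + m))))
    with ((x ^ m * x ^ m) * x ^ S (S N) / INR (S (N + m))).
  2: { unfold Rdiv. rewrite <- !Rmult_assoc, <- !pow_add.
       apply (f_equal (fun k => x ^ k * / INR (S (N + m)))). lia. }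
  rewrite X2. field; lra.
Qed.

(** * Products of Dirichlet series *)

Lemma psum_swap (f : nat -> nat -> R) M N :
  psum (fun i => psum (fun j => f i j) N) M
  = psum (fun j => psum (fun i => f i j) M) N.
Proof.
  induction M as [|M IH]; simpl.
  - rewrite psum_const; lra.
  - now rewrite IH, psum_plus.
Qed.

(* The diagonal correction has coefficient [k + 2] rather than [k] because
   both occurrences of [/ (u - v)] are [/ 0 = 0] there. *)
Lemma partial_fraction k u v : u <> 0 -> v <> 0 ->
  psum (fun i => / u ^ S i * / v ^ (k + 2 - i)) k =
  / u ^ (k + 2) * (/ (v - u) - / v) - / v ^ (k + 2) * (/ u - / (u - v))
  + (if Req_EM_T u v then INR (k + 2) * / u ^ (k + 3) else 0).
Proof.
  intros Hu Hv. destruct (Req_EM_T u v) as [<- | Huv].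
  - rewrite Rminus_diag, Rinv_0, (psum_ext _ (fun _ => / u ^ (k + 3))).
    + rewrite psum_const, !plus_INR.
      replace (k + 3)%nat with (S (k + 2)) by lia.
      simpl pow. simpl INR. field. split; [now apply pow_nonzero|easy].
    + intros i Hi. rewrite <- Rinv_mult, <- pow_add. do 2 f_equal; lia.
  - induction k as [|k IH].
    + simpl. field. repeat split; lra.
    + cbn [psum].
      rewrite (psum_ext _ (fun i => / v * (/ u ^ S i * / v ^ (k + 2 - i)))).
      * rewrite psum_scal, IH.
        replace (S k + 2 - S k)%nat with 2%nat by lia.
        replace (S k + 2)%nat with (S (k + 2)) by lia.
        replace (S (S k)) with (k + 2)%nat by lia.
        pose proof (pow_nonzero u (k + 2) Hu) as Pu.
        pose proof (pow_nonzero v (k + 2) Hv) as Pv.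
        cbn [pow].
        field. repeat split; lra.
      * intros i Hi. replace (S k + 2 - i)%nat with (S (k + 2 - i)) by lia.
        rewrite <- (tech_pow_Rmult v), Rinv_mult. ring.
Qed.

Lemma Rabs_le_H_sq c C n : (1 <= n)%nat -> Rabs c <= C * H n ->
  Rabs c <= C * H n ^ 2.
Proof.
  intros Hn Hc. pose proof (H_ge_1 n Hn). pose proof (Rabs_pos c).
  assert (0 <= C) by nra. nra.
Qed.

(** The product formula for u = m and v = s n, solved for the sum over n. [I] is the kernel sum over
    n and [T] the kernel sum over m; the powers of [s] come from those of v. The factor (1 + s) / 2
    is 1 or 0 according to the sign, because the diagonal u = v is met only when s = 1. The bound on
    truncated kernel sums is uniform in [N], which is what dominated convergence requires. *)
Lemma is_sum_product_kernel (s C : R) (a b I T : nat -> R) (k : nat) :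
  s = 1 \/ s = -1 ->
  (forall m, (1 <= m)%nat -> Rabs (a m) <= C * H m) ->
  (forall n, (1 <= n)%nat -> Rabs (b n) <= 1) ->
  (forall N m, (1 <= m)%nat ->
    Rabs (psum (fun n => b n * (/ (s * INR n - INR m) - / (s * INR n))) N)
    <= C * H m) ->
  (forall m, (1 <= m)%nat ->
    is_sum (fun n => b n * (/ (s * INR n - INR m) - / (s * INR n))) (I m)) ->
  (forall n, (1 <= n)%nat ->
    is_sum (fun m => a m * (/ INR m - / (INR m - s * INR n))) (T n)) ->
  is_sum (fun n => b n * / (s * INR n) ^ (k + 2) * T n)
    ((1 + s) / 2 * INR (k + 2) * Series1 (fun m => a m * b m / INR m ^ (k + 3))
     + Series1 (fun m => a m * I m / INR m ^ (k + 2))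
     - psum (fun i => Series1 (fun m => a m / INR m ^ S i)
                 * (s ^ (k + 2 - i)
                    * Series1 (fun n => b n / INR n ^ (k + 2 - i)))) k).
Proof.
  intros Hs Ha Hb HIb HI HT.
  set (IN := fun N m =>
    psum (fun n => b n * (/ (s * INR n - INR m) - / (s * INR n))) N) in *.
  set (D := fun m => (1 + s) / 2 * INR (k + 2) * (a m * b m / INR m ^ (k + 3))).
  set (A := fun i => Series1 (fun m => a m / INR m ^ S i)).
  assert (HC : 0 <= C).
  { specialize (Ha 1%nat (le_n 1)). rewrite H_1 in Ha.
    pose proof (Rabs_pos (a 1%nat)). lra. }
  assert (Hq : 0 <= INR (k + 2)) by apply pos_INR.
  assert (Is : / s = s) by (destruct Hs as [-> | ->]; lra).
  assert (HIl : forall m, (1 <= m)%nat -> Rabs (I m) <= C * H m).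
  { intros m Hm. apply (is_lim_seq_le (fun N => Rabs (IN N m)) (fun _ => C * H m)
             (Rabs (I m)) (C * H m)).
    - intros N. now apply HIb.
    - apply (is_lim_seq_abs _ (I m)). now apply HI.
    - apply is_lim_seq_const. }
  assert (Hab : forall m, (1 <= m)%nat -> Rabs (a m * b m) <= C * H m ^ 2).
  { intros m Hm. apply Rabs_le_H_sq; [easy|]. rewrite Rabs_mult.
    specialize (Ha m Hm). specialize (Hb m Hm).
    pose proof (Rabs_pos (a m)). pose proof (Rabs_pos (b m)). nra. }
  assert (HaI : forall x m, (1 <= m)%nat -> Rabs x <= C * H m ->
            Rabs (a m * x) <= (C * C) * H m ^ 2).
  { intros x m Hm Hx. rewrite Rabs_mult.
    replace (C * C * H m ^ 2) with ((C * H m) * (C * H m)) by ring.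
    apply Rmult_le_compat; auto using Rabs_pos. }
  assert (HA : forall i, (1 <= i)%nat ->
            is_sum (fun m => a m / INR m ^ S i) (A i)).
  { intros i Hi. apply (is_sum_div_pow a C); [lia|].
    intros n Hn. apply Rabs_le_H_sq; auto. }
  assert (HB : forall i, (1 <= i <= k)%nat ->
            is_sum (fun n => b n / INR n ^ (k + 2 - i))
              (Series1 (fun n => b n / INR n ^ (k + 2 - i)))).
  { intros i Hi. apply (is_sum_div_pow b 1); [lia|].
    intros n Hn. apply Rabs_le_H_sq; [easy|].
    specialize (Hb n Hn). pose proof (H_ge_1 n Hn). lra. }
  set (BN := fun N i => s ^ (k + 2 - i) * psum (fun n => b n / INR n ^ (k + 2 - i)) N).
  (* The summand in m once n is cut at [N]; the diagonal correction enters when [N] reaches m. *)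
  set (f := fun N m => a m * IN N m / INR m ^ (k + 2)
                       + (if Nat.leb m N then D m else 0)).
  (* The same truncated double sum with the series over m evaluated first: kernel sums [T n], plus
     products in which only the series in n is truncated. *)
  set (W := fun N => psum (fun n => b n * / (s * INR n) ^ (k + 2) * T n) N
                     + psum (fun i => BN N i * A i) k).
  assert (Hf : forall N, is_sum (f N) (W N)).
  { intros N. eapply is_sum_ext; [|apply is_sum_plus].
    2: { apply (is_sum_psum (fun n m => b n * / (s * INR n) ^ (k + 2)
                 * (a m * (/ INR m - / (INR m - s * INR n))))).
         intros n Hn. apply is_sum_scal, HT; lia. }
    2: { apply (is_sum_psum (fun i m => BN N i * (a m / INR m ^ S i))).
         intros i Hi. apply is_sum_scal, HA; lia. }
    intros m Hm. cbv beta.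
    pose proof (INR_gt_0 m Hm) as Pm.
    rewrite (psum_ext (fun i => BN N i * (a m / INR m ^ S i))
      (fun i => psum (fun n => a m * b n *
         (/ INR m ^ S i * / (s * INR n) ^ (k + 2 - i))) N)).
    2: { intros i Hi. unfold BN. rewrite Rmult_comm, <- psum_scal, <- psum_scal.
         apply psum_ext. intros n Hn.
         rewrite Rpow_mult_distr, Rinv_mult, <- (pow_inv s), Is.
         unfold Rdiv; ring. }
    rewrite psum_swap, <- psum_plus.
    unfold f, IN.
    rewrite <- (psum_single (D m) m N Hm).
    unfold Rdiv at 1. rewrite (Rmult_comm (a m)), Rmult_assoc, Rmult_comm,
      <- psum_scal, <- psum_plus.
    apply psum_ext. intros n Hn.
    pose proof (INR_gt_0 n (proj1 Hn)) as Pn.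
    rewrite psum_scal, partial_fraction by (destruct Hs as [-> | ->]; lra).
    assert (ED : (if Req_EM_T (INR m) (s * INR n)
               then INR (k + 2) * / INR m ^ (k + 3) else 0) * (a m * b n)
              = if Nat.eqb n m then D m else 0).
    { destruct (Req_EM_T (INR m) (s * INR n)) as [E | E],
        (Nat.eqb_spec n m) as [E' | E'].
      - subst n. assert (s = 1) as -> by (destruct Hs as [-> | ->]; lra).
        unfold D, Rdiv. field. now apply pow_nonzero, Rgt_not_eq.
      - exfalso. apply E'. destruct Hs as [-> | ->]; [|lra].
        apply INR_eq. lra.
      - subst n. destruct Hs as [-> | ->]; [lra|]. unfold D.
        replace (1 + -1) with 0 by lra. unfold Rdiv; ring.
      - ring. }
    rewrite <- ED. ring. }
  set (l := fun m => a m * I m / INR m ^ (k + 2) + D m).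
  assert (Hl : is_sum l (Series1 (fun m => a m * I m / INR m ^ (k + 2))
     + (1 + s) / 2 * INR (k + 2) * Series1 (fun m => a m * b m / INR m ^ (k + 3)))).
  { apply is_sum_plus; [|apply is_sum_scal].
    - apply (is_sum_div_pow (fun m => a m * I m) (C * C)); [lia|]. auto.
    - apply (is_sum_div_pow (fun m => a m * b m) C); [lia|]. auto. }
  destruct is_sum_H_sq as [G HG].
  (* The majorant has two parts: C^2 from a_m times the truncated kernel sum, each at most C H_m,
     and (k + 2) C from the diagonal term. *)
  apply (is_sum_scal (C * C + INR (k + 2) * C)) in HG.
  assert (HW : is_lim_seq W (Series1 (fun m => a m * I m / INR m ^ (k + 2))
     + (1 + s) / 2 * INR (k + 2) * Series1 (fun m => a m * b m / INR m ^ (k + 3)))).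
  { refine (is_sum_dominated_convergence f _ l W _ _ _ _ HG Hf Hl).
    - intros N m Hm. unfold f.
      pose proof (INR_gt_0 m Hm) as Pm.
      assert (P2 : 0 < / INR m ^ 2) by (apply Rinv_0_lt_compat, pow_lt, Pm).
      assert (forall x i, (2 <= i)%nat -> Rabs (x / INR m ^ i) <= Rabs x * / INR m ^ 2) as Hx.
      { intros x i Hi. unfold Rdiv. rewrite Rabs_mult.
        rewrite (Rabs_pos_eq (/ _)) by (left; apply Rinv_0_lt_compat, pow_lt, Pm).
        apply Rmult_le_compat_l; [apply Rabs_pos|]. now apply Rdiv_pow_le. }
      eapply Rle_trans; [apply Rabs_triang|].
      replace ((C * C + INR (k + 2) * C) * (H m ^ 2 / INR m ^ 2))
        with (C * C * H m ^ 2 * / INR m ^ 2 + INR (k + 2) * C * H m ^ 2 * / INR m ^ 2)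
        by (unfold Rdiv; ring).
      apply Rplus_le_compat.
      + eapply Rle_trans; [apply Hx; lia|].
        apply Rmult_le_compat_r; [lra|]. apply HaI; [easy|now apply HIb].
      + assert (HD : Rabs (D m) <= INR (k + 2) * C * H m ^ 2 * / INR m ^ 2).
        { unfold D. rewrite !Rabs_mult, (Rabs_pos_eq (INR (k + 2))) by easy.
          assert (S1 : Rabs ((1 + s) / 2) <= 1)
            by (destruct Hs as [-> | ->]; apply Rabs_le; lra).
          pose proof (Rabs_pos ((1 + s) / 2)) as S0.
          assert (B1 : Rabs (a m * b m / INR m ^ (k + 3)) <= C * H m ^ 2 * / INR m ^ 2).
          { eapply Rle_trans; [apply Hx; lia|].
            apply Rmult_le_compat_r; [lra|]. now apply Hab. }
          pose proof (Rabs_pos (a m * b m / INR m ^ (k + 3))) as B0.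
          rewrite !Rmult_assoc. rewrite Rmult_assoc in B1.
          rewrite <- (Rmult_1_l (INR (k + 2) * (C * _))).
          apply Rmult_le_compat; try easy.
          - now apply Rmult_le_pos.
          - now apply Rmult_le_compat_l. }
        destruct (Nat.leb m N); [easy|]. rewrite Rabs_R0.
        eapply Rle_trans; [apply Rabs_pos|exact HD].
    - intros m Hm. unfold f, l. apply is_lim_seq_plus'.
      + unfold Rdiv. apply is_lim_seq_mult'; [|apply is_lim_seq_const].
        apply is_lim_seq_mult'; [apply is_lim_seq_const|]. now apply HI.
      + eapply is_lim_seq_ext_loc; [|apply is_lim_seq_const].
        exists m; intros N HN. destruct (Nat.leb_spec m N); lia || easy. }
  unfold is_sum.
  apply (is_lim_seq_ext (fun N => W N - psum (fun i => BN N i * A i) k)).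
  { intros N. unfold W. ring. }
  rewrite (Rplus_comm (_ * _)).
  apply is_lim_seq_minus'; [exact HW|].
  rewrite (psum_ext _ (fun i => (s ^ (k + 2 - i)
        * Series1 (fun n => b n / INR n ^ (k + 2 - i))) * A i))
    by (intros; unfold A; ring).
  apply (is_lim_seq_psum (fun N i => BN N i * A i)). intros i Hi.
  apply is_lim_seq_mult'; [|apply is_lim_seq_const].
  apply is_lim_seq_mult'; [apply is_lim_seq_const|]. now apply HB.
Qed.

(** * Alternating harmonic numbers *)

(** Agrees with (-1)^(n-1) for n >= 1, without truncated subtraction. *)
Definition sg (n : nat) : R := (-1) ^ S n.

Lemma sg_S n : sg (S n) = - sg n.
Proof. unfold sg. simpl. ring. Qed.

Lemma sg_cases n : sg n = 1 /\ (-1) ^ n = -1 \/ sg n = -1 /\ (-1) ^ n = 1.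
Proof.
  unfold sg. induction n as [|n IH]; [simpl; lra|].
  cbn [pow] in *. lra.
Qed.

Lemma pow_m1_sq i : (-1) ^ i * (-1) ^ i = 1.
Proof. destruct (sg_cases i); nra. Qed.

Lemma pow_m1_sg n : (-1) ^ n = - sg n.
Proof. destruct (sg_cases n); lra. Qed.

Lemma Rabs_sg n : Rabs (sg n) = 1.
Proof. apply pow_1_abs. Qed.

Lemma L_1_S n : L (S n) 1 = L n 1 + (-1) ^ n / INR (S n).
Proof. now rewrite L_S, pow_1. Qed.

Lemma psum_sg_L n : psum (fun j => sg j / INR j) n = L n 1.
Proof.
  induction n as [|n IH]; [now rewrite L_0|].
  cbn [psum]. rewrite L_1_S, IH. f_equal. unfold sg. f_equal. simpl. ring.
Qed.

Lemma psum_inv_H n : psum (fun j => 1 ^ S j / INR j) n = H n.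
Proof.
  unfold H. rewrite sum_n_m_psum. apply psum_ext. intros j _.
  rewrite pow1. unfold Rdiv. ring.
Qed.

(** Both bounds are 1 + t <= exp t, at t = -1/(x + 1) and at t = 1/x. *)
Lemma ln_succ_bounds x : 0 < x -> / (x + 1) <= ln (x + 1) - ln x <= / x.
Proof.
  intros Hx. rewrite <- ln_div by lra. split.
  - replace ((x + 1) / x) with (/ (x / (x + 1))) by (field; lra).
    rewrite ln_Rinv by (apply Rdiv_lt_0_compat; lra).
    enough (ln (x / (x + 1)) <= - / (x + 1)) by lra.
    rewrite <- (ln_exp (- / (x + 1))). apply Rcomplements.ln_le.
    + apply Rdiv_lt_0_compat; lra.
    + pose proof (exp_ineq1_le (- / (x + 1))) as E.
      replace (x / (x + 1)) with (1 + - / (x + 1)) by (field; lra). lra.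
  - rewrite <- (ln_exp (/ x)). apply Rcomplements.ln_le.
    + apply Rdiv_lt_0_compat; lra.
    + pose proof (exp_ineq1_le (/ x)) as E.
      replace ((x + 1) / x) with (1 + / x) by (field; lra). lra.
Qed.

Lemma H_ln_bounds a b : (1 <= a)%nat ->
  H (b + a) - H a <= ln (INR (b + a)) - ln (INR a)
  <= H (b + a) - H a + / INR a - / INR (b + a).
Proof.
  intros Ha. induction b as [|b IH]; cbn [Nat.add]; [lra|].
  rewrite H_S, S_INR.
  pose proof (ln_succ_bounds (INR (b + a)) (INR_gt_0 (b + a) ltac:(lia))). lra.
Qed.

(** The Botez-Catalan identity: the alternating sum is the full sum minus twice its even part, and
    twice that part is H_m. *)
Lemma L_even_H m : L (m + m) 1 = H (m + m) - H m.
Proof.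
  induction m as [|m IH]; [simpl; rewrite L_0, H_0; lra|].
  replace (S m + S m)%nat with (S (S (m + m))) by lia.
  rewrite !L_1_S, !H_S, IH.
  replace ((-1) ^ S (m + m)) with (- (-1) ^ (m + m)) by (simpl; ring).
  assert ((-1) ^ (m + m) = 1) as -> by now rewrite pow_add, pow_m1_sq.
  rewrite !S_INR, plus_INR. pose proof (pos_INR m). field. lra.
Qed.

(** H_(2m) - H_m is compared with ln (2m) - ln m = ln 2. The explicit rate yields both the limit of
    [L] and a bound uniform in the index. *)
Lemma L_even_ln2_bound m : 0 <= ln 2 - L (m + m) 1 <= 2 * / INR (S (m + m)).
Proof.
  destruct m as [|m].
  { pose proof (ln_succ_bounds 1 Rlt_0_1) as B.
    replace (1 + 1) with 2 in B by ring. rewrite ln_1 in B. simpl. rewrite L_0. lra. }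
  rewrite L_even_H.
  pose proof (H_ln_bounds (S m) (S m) ltac:(lia)) as B.
  rewrite <- ln_div in B by (apply lt_0_INR; lia).
  assert (Pm := INR_S_pos m).
  replace (INR (S m + S m) / INR (S m)) with 2 in B
    by (rewrite plus_INR; field; lra).
  rewrite (S_INR (S m + S m)).
  rewrite plus_INR in *.
  set (x := INR (S m)) in *.
  assert (Hx : 1 <= x) by (apply (le_INR 1); lia).
  replace (2 * / (x + x + 1))
    with (/ x - / (x + x) + (2 * x - 1) * / (2 * x * (2 * x + 1))) by (field; lra).
  assert (0 <= (2 * x - 1) * / (2 * x * (2 * x + 1))).
  { apply Rmult_le_pos; [lra|]. left. apply Rinv_0_lt_compat. nra. }
  lra.
Qed.

Lemma L_ln2_bound n : Rabs (L n 1 - ln 2) <= 2 * / INR (S n).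
Proof.
  destruct (Nat.Even_or_Odd n) as [[m E] | [m E]];
    pose proof (L_even_ln2_bound m) as B.
  - replace n with (m + m)%nat by lia. apply Rabs_le. lra.
  - replace n with (S (m + m)) by lia. rewrite L_1_S.
    assert ((-1) ^ (m + m) = 1) as -> by now rewrite pow_add, pow_m1_sq.
    rewrite !S_INR, plus_INR in *. pose proof (pos_INR m) as Pm.
    set (x := INR m) in *.
    replace (2 * / (x + x + 1 + 1))
      with (/ (x + x + 1) + (2 * x) * / ((2 * x + 1) * (2 * x + 2))) by (field; lra).
    assert (0 <= (2 * x) * / ((2 * x + 1) * (2 * x + 2))).
    { apply Rmult_le_pos; [lra|]. left. apply Rinv_0_lt_compat. nra. }
    apply Rabs_le. lra.
Qed.

Lemma is_lim_seq_L : is_lim_seq (fun n => L n 1) (ln 2).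
Proof.
  apply (is_lim_seq_ext (fun n => (L n 1 - ln 2) + ln 2)); [intros; ring|].
  replace (Finite (ln 2)) with (Finite (0 + ln 2)) by (f_equal; ring).
  apply is_lim_seq_plus'; [|apply is_lim_seq_const].
  apply is_lim_seq_abs_0.
  apply (is_lim_seq_le_le (fun _ => 0) _ (fun n => 2 * / INR (S n))).
  - intros n. split; [apply Rabs_pos|apply L_ln2_bound].
  - apply is_lim_seq_const.
  - replace (Finite 0) with (Rbar_mult 2 0) by (simpl; now rewrite Rmult_0_r).
    apply is_lim_seq_scal_l, is_lim_seq_inv_INR_S.
Qed.

Lemma L_bound n : Rabs (L n 1) <= 3.
Proof.
  pose proof (L_ln2_bound n) as B. pose proof (ln_succ_bounds 1 Rlt_0_1) as B2.
  replace (1 + 1) with 2 in B2 by ring. rewrite ln_1 in B2.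
  assert (/ INR (S n) <= / 1).
  { apply Rinv_le_contravar; [lra|]. apply (le_INR 1). lia. }
  replace (L n 1) with ((L n 1 - ln 2) + ln 2) by ring.
  eapply Rle_trans; [apply Rabs_triang|].
  rewrite (Rabs_pos_eq (ln 2)) by lra. lra.
Qed.

(** * Sums over [m] with the kernels [1 / (m - n)] and [1 / (m + n)] *)

(** Disposes of the boundary terms of the Abel summations below. H_n / n tends to 0 because its
    square is the general term of the convergent series of [is_sum_H_sq]. *)
Lemma is_lim_seq_H_ratio z c : (forall n, Rabs (c n) <= 3 * H n) ->
  is_lim_seq (fun n => c n / (INR n + z)) 0.
Proof.
  intros Hc.
  assert (I0 : is_lim_seq (fun n => / INR n) 0)
    by (apply is_lim_seq_incr_1, is_lim_seq_inv_INR_S).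
  assert (R0 : is_lim_seq (fun n => H n / INR n) 0).
  { destruct is_sum_H_sq as [G HG].
    assert (D : is_lim_seq (fun n => H (S n) ^ 2 / INR (S n) ^ 2) 0).
    { apply (is_lim_seq_ext (fun n => psum (fun n => H n ^ 2 / INR n ^ 2) (S n)
                              - psum (fun n => H n ^ 2 / INR n ^ 2) n)).
      - intros n. cbn [psum]. ring.
      - rewrite <- (Rminus_diag G). apply is_lim_seq_minus'; [|exact HG].
        now apply is_lim_seq_incr_1 in HG. }
    apply is_lim_seq_incr_1.
    apply (is_lim_seq_continuous sqrt _ _ (continuity_pt_sqrt 0 (Rle_refl 0))) in D.
    rewrite sqrt_0 in D. eapply is_lim_seq_ext; [|exact D].
    intros n. cbv beta.
    replace (H (S n) ^ 2 / INR (S n) ^ 2) with (Rsqr (H (S n) / INR (S n)))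
      by (unfold Rsqr; pose proof (INR_S_pos n); field; lra).
    apply sqrt_Rsqr. apply Rdiv_le_0_compat; [apply H_nonneg|apply INR_S_pos]. }
  assert (C0 : is_lim_seq (fun n => c n / INR n) 0).
  { apply is_lim_seq_abs_0.
    apply (is_lim_seq_le_le (fun _ => 0) _ (fun n => 3 * (H n / INR n))).
    - intros n. split; [apply Rabs_pos|]. unfold Rdiv.
      rewrite Rabs_mult, <- Rmult_assoc.
      assert (0 <= / INR n).
      { destruct n; [simpl; rewrite Rinv_0; lra|].
        left. apply Rinv_0_lt_compat, INR_S_pos. }
      rewrite (Rabs_pos_eq (/ _)) by easy. now apply Rmult_le_compat_r.
    - apply is_lim_seq_const.
    - replace (Finite 0) with (Rbar_mult 3 0) by (simpl; now rewrite Rmult_0_r).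
      now apply is_lim_seq_scal_l. }
  apply (is_lim_seq_ext_loc (fun n => c n / INR n * / (1 + z * / INR n))).
  (* [z] may be a negative integer; since / 0 = 0, [Rinv_mult] holds without side condition and the
     identity survives at n = - z. *)
  { exists 1%nat. intros n Hn. pose proof (INR_gt_0 n Hn).
    unfold Rdiv. rewrite Rmult_assoc, <- Rinv_mult. do 2 f_equal. field. lra. }
  replace (Finite 0) with (Finite (0 * / (1 + z * 0))) by (f_equal; ring).
  apply is_lim_seq_mult'; [exact C0|].
  apply (is_lim_seq_inv _ (1 + z * 0)).
  - apply is_lim_seq_plus'; [apply is_lim_seq_const|].
    apply (is_lim_seq_scal_l _ z 0 I0).
  - intros E. injection E. lra.
Qed.

Lemma is_sum_sg_inv : is_sum (fun n => sg n / INR n) (ln 2).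
Proof.
  eapply is_lim_seq_ext; [intros n; symmetry; apply psum_sg_L|apply is_lim_seq_L].
Qed.

Lemma is_lim_seq_sub (u : nat -> R) l a : is_lim_seq u l ->
  is_lim_seq (fun n => u (n - a)%nat) l.
Proof.
  intros Hu. apply (is_lim_seq_incr_n _ a).
  eapply is_lim_seq_ext; [|exact Hu]. intros n. simpl. f_equal. lia.
Qed.

Lemma is_lim_seq_sub_l (u : nat -> R) a : is_lim_seq (fun n => u (a - n)%nat) (u 0%nat).
Proof.
  eapply is_lim_seq_ext_loc; [|apply is_lim_seq_const].
  exists a. intros n Hn. f_equal. lia.
Qed.

Lemma psum_sg_down m N : (1 <= m)%nat ->
  psum (fun n => sg n / (INR n - INR m)) N
  = (-1) ^ m * (L (N - m) 1 + L (m - 1 - N) 1 - L (m - 1) 1).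
Proof.
  intros Hm. rewrite <- !psum_sg_L. apply psum_shift_down; [lra|easy].
Qed.

Lemma is_sum_sg_down n : (1 <= n)%nat ->
  is_sum (fun m => sg m / (INR m - INR n)) ((-1) ^ n * (ln 2 - L (n - 1) 1)).
Proof.
  intros Hn. eapply is_lim_seq_ext; [intros N; symmetry; now apply psum_sg_down|].
  apply is_lim_seq_mult'; [apply is_lim_seq_const|].
  apply is_lim_seq_minus'; [|apply is_lim_seq_const].
  rewrite <- (Rplus_0_r (ln 2)), <- (L_0 1).
  apply is_lim_seq_plus'.
  - apply (is_lim_seq_sub (fun n => L n 1)), is_lim_seq_L.
  - apply (is_lim_seq_sub_l (fun n => L n 1)).
Qed.

Lemma is_sum_sg_up n :
  is_sum (fun m => sg m / (INR m + INR n)) ((-1) ^ n * (ln 2 - L n 1)).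
Proof.
  eapply is_lim_seq_ext.
  { intros N. symmetry. unfold sg. apply psum_shift_up. lra. }
  apply is_lim_seq_mult'; [apply is_lim_seq_const|].
  apply is_lim_seq_minus'; [|].
  - eapply is_lim_seq_ext; [intros N; symmetry; apply psum_sg_L|].
    pose proof is_lim_seq_L as A. now apply (is_lim_seq_incr_n _ n) in A.
  - rewrite <- psum_sg_L. apply is_lim_seq_const.
Qed.

(** Off the diagonal, 1/(m (m - n)) = (1/n) (1/(m - n) - 1/m). At m = n the left side is 0 by
    convention and the right side is -1/n^2; the last term of the value compensates for this. *)
Lemma is_sum_sg_inv_down n : (1 <= n)%nat ->
  is_sum (fun m => sg m / INR m / (INR m - INR n))
    (/ INR n * ((-1) ^ n * (ln 2 - L (n - 1) 1) - ln 2) + sg n / INR n ^ 2).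
Proof.
  intros Hn. eapply is_sum_ext.
  2: { apply is_sum_plus; [apply is_sum_scal, is_sum_minus|].
       - now apply is_sum_sg_down.
       - apply is_sum_sg_inv.
       - apply (is_sum_single _ n Hn). }
  intros m Hm. cbv beta. pose proof (INR_gt_0 m Hm). pose proof (INR_gt_0 n Hn).
  destruct (Nat.eqb_spec m n) as [-> | E].
  - rewrite Rminus_diag. unfold Rdiv at 1 4. rewrite Rinv_0. field. lra.
  - pose proof (INR_minus_neq m n E). field. lra.
Qed.

Lemma is_sum_sg_inv_up n : (1 <= n)%nat ->
  is_sum (fun m => sg m / INR m / (INR m + INR n))
    (/ INR n * (ln 2 - (-1) ^ n * (ln 2 - L n 1))).
Proof.
  intros Hn. eapply is_sum_ext.
  2: { apply is_sum_scal, is_sum_minus; [apply is_sum_sg_inv|apply (is_sum_sg_up n)]. }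
  intros m Hm. cbv beta. pose proof (INR_gt_0 m Hm). pose proof (INR_gt_0 n Hn).
  field. lra.
Qed.

Definition H2 (n : nat) : R := psum (fun j => / INR j ^ 2) n.

(** Abel summation: 1/(m - z) is 1/(m - (z + 1)) taken at m + 1, so only the increments of [L] and a
    boundary term survive. *)
Lemma psum_L_shift z M :
  psum (fun m => L m 1 * (/ (INR m - z) - / (INR m - (z + 1)))) M
  = L M 1 / (INR M + - z) - psum (fun m => sg m / INR m / (INR m - (z + 1))) M.
Proof.
  induction M as [|M IH].
  - simpl. rewrite L_0. unfold Rdiv. ring.
  - cbn [psum]. rewrite IH, L_1_S.
    replace (INR (S M) - (z + 1)) with (INR M + - z) by (rewrite S_INR; ring).
    replace (sg (S M)) with ((-1) ^ M) by (unfold sg; simpl; ring).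
    unfold Rdiv, Rminus. ring.
Qed.

(** Induction on n: at n = 0 the kernel vanishes, and [psum_L_shift] gives each increment. The
    square arises because L_n^2 - H_n(2) grows by 2 (-1)^n L_n / (n + 1). *)
Lemma is_sum_L_kernel n :
  is_sum (fun m => L m 1 * (/ INR m - / (INR m - INR n)))
    (ln 2 * (L n 1 + H n) - L n 2 - / 2 * (L n 1 ^ 2 - H2 n)).
Proof.
  induction n as [|n IH].
  - rewrite L_0, L_0, H_0. unfold H2. simpl psum.
    eapply is_sum_ext.
    2: { replace (ln 2 * (0 + 0) - 0 - / 2 * (0 ^ 2 - 0)) with (0 * ln 2) by ring.
         apply is_sum_scal, is_sum_sg_inv. }
    intros m _. simpl INR. rewrite Rminus_0_r. ring.
  - assert (A : is_sum (fun m => L m 1 * (/ (INR m - INR n) - / (INR m - (INR n + 1))))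
       (0 - (/ INR (S n) * ((-1) ^ S n * (ln 2 - L (S n - 1) 1) - ln 2)
             + sg (S n) / INR (S n) ^ 2))).
    { eapply is_lim_seq_ext; [intros N; symmetry; apply psum_L_shift|].
      apply is_lim_seq_minus'.
      - apply is_lim_seq_H_ratio. intros m. destruct m as [|m].
        + rewrite L_0, Rabs_R0, H_0. lra.
        + pose proof (L_bound (S m)). pose proof (H_ge_1 (S m) ltac:(lia)). lra.
      - rewrite <- S_INR. apply (is_sum_sg_inv_down (S n)). lia. }
    pose proof (is_sum_plus _ _ _ _ IH A) as B.
    eapply is_sum_ext; [|eapply eq_rect; [exact B|]].
    + intros m _. cbv beta. rewrite S_INR. ring.
    + unfold H2. cbn [psum]. rewrite H_S, !L_S, pow_1.
      replace (S n - 1)%nat with n by lia.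
      replace (sg (S n)) with ((-1) ^ n) by (unfold sg; simpl; ring).
      cbn [pow]. pose proof (INR_S_pos n).
      destruct (sg_cases n) as [[_ ->] | [_ ->]]; field; lra.
Qed.

(** Abel summation again; [sg] changes sign under the shift, so it is the sum of two consecutive
    kernels that telescopes. *)
Lemma psum_sg_H_shift z M :
  psum (fun m => sg m * H m * (/ (INR m + z) + / (INR m + (z + 1)))) M
  = psum (fun m => sg m / INR m / (INR m + z)) M + sg M * H M / (INR M + (z + 1)).
Proof.
  induction M as [|M IH].
  - simpl. rewrite H_0. unfold Rdiv. ring.
  - cbn [psum]. rewrite IH, H_S, sg_S.
    replace (INR (S M) + z) with (INR M + (z + 1)) by (rewrite S_INR; ring).
    unfold Rdiv. ring.
Qed.

Lemma is_sum_sg_H_shift z l :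
  is_sum (fun m => sg m / INR m / (INR m + z)) l ->
  is_sum (fun m => sg m * H m * (/ (INR m + z) + / (INR m + (z + 1)))) l.
Proof.
  intros Hl. eapply is_lim_seq_ext; [intros N; symmetry; apply psum_sg_H_shift|].
  rewrite <- (Rplus_0_r l). apply is_lim_seq_plus'; [exact Hl|].
  apply is_lim_seq_H_ratio. intros n. rewrite Rabs_mult, Rabs_sg, Rabs_pos_eq by apply H_nonneg.
  pose proof (H_nonneg n). lra.
Qed.

(** Subtracting the upward Abel relation from the downward one gives the sum of the values at n and
    n + 1, hence a recursion in n. *)
Lemma is_sum_sg_H_kernel n : (1 <= n)%nat ->
  is_sum (fun m => sg m * H m * (/ (INR m - INR n) - / (INR m + INR n)))
    ((-1) ^ n * (Series1 (fun m => sg m / INR m ^ 2) - H2 n + L n 2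
                 + ((1 - (-1) ^ n) * ln 2 - L n 1) / INR n)).
Proof.
  set (Z2 := Series1 (fun m => sg m / INR m ^ 2)).
  assert (HZ : is_sum (fun m => sg m / INR m ^ 2) Z2).
  { apply (is_sum_div_pow sg 1); [lia|]. intros m Hm. apply Rabs_le_H_sq; [easy|].
    rewrite Rabs_sg. pose proof (H_ge_1 m Hm). lra. }
  assert (Down : forall n, is_sum (fun m => sg m * H m *
      (/ (INR m - INR (S n)) + / (INR m - INR n)))
      (/ INR (S n) * ((-1) ^ S n * (ln 2 - L n 1) - ln 2) + sg (S n) / INR (S n) ^ 2)).
  { intros n0. pose proof (is_sum_sg_inv_down (S n0) ltac:(lia)) as D.
    apply (is_sum_sg_H_shift (- INR (S n0))) in D.
    replace (S n0 - 1)%nat with n0 in D by lia.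
    eapply is_sum_ext; [|exact D]. intros m _. cbv beta.
    replace (- INR (S n0) + 1) with (- INR n0) by (rewrite S_INR; ring). easy. }
  intros Hn. induction Hn as [|n Hn IH].
  (* At the start the downward shifts are -1, 0 and the upward ones 0, 1; the common kernel 1/m
     cancels and leaves the value at n = 1. *)
  - assert (U : is_sum (fun m => sg m / INR m / (INR m + 0)) Z2).
    { eapply is_sum_ext; [|exact HZ]. intros m Hm. cbv beta.
      pose proof (INR_gt_0 m Hm). field. lra. }
    apply is_sum_sg_H_shift in U.
    pose proof (is_sum_minus _ _ _ _ (Down 0%nat) U) as B.
    eapply is_sum_ext; [|eapply eq_rect; [exact B|]].
    + intros m _. cbv beta. simpl INR.
      rewrite Rminus_0_r, Rplus_0_r, Rplus_0_l. ring.
    + unfold H2, sg. cbn [psum]. rewrite !L_S, !L_0. simpl. field.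
  - pose proof (is_sum_sg_inv_up n Hn) as U. apply is_sum_sg_H_shift in U.
    pose proof (is_sum_minus _ _ _ _ (is_sum_minus _ _ _ _ (Down n) U) IH) as B.
    eapply is_sum_ext; [|eapply eq_rect; [exact B|]].
    + intros m _. cbv beta. rewrite S_INR. ring.
    + unfold H2. cbn [psum]. rewrite !L_S, pow_1.
      replace (sg (S n)) with ((-1) ^ n) by (unfold sg; simpl; ring).
      cbn [pow]. pose proof (INR_S_pos n). pose proof (INR_gt_0 n Hn).
      destruct (sg_cases n) as [[_ ->] | [_ ->]]; field; lra.
Qed.

(** * Relations between alternating Euler sums *)

(** The Dirichlet series of [c] at [i], the common form into which every zeta and zeta-star value is
    translated. *)
Definition Dir (c : nat -> R) (i : nat) : R := Series1 (fun n => c n / INR n ^ i).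

Lemma is_sum_Dir c i : (2 <= i)%nat ->
  (exists C, forall n, (1 <= n)%nat -> Rabs (c n) <= C * H n ^ 2) ->
  is_sum (fun n => c n / INR n ^ i) (Dir c i).
Proof. intros Hi [C HC]. now apply (is_sum_div_pow c C). Qed.

Lemma H_sq_ge_1 n : (1 <= n)%nat -> 1 <= H n /\ H n <= H n ^ 2 /\ 1 <= H n ^ 2.
Proof. intros Hn. pose proof (H_ge_1 n Hn). nra. Qed.

Lemma L_2_bound n : Rabs (L n 2) <= H n.
Proof.
  induction n as [|n IH]; [rewrite L_0, Rabs_R0, H_0; lra|].
  rewrite L_S, H_S. eapply Rle_trans; [apply Rabs_triang|].
  apply Rplus_le_compat; [exact IH|].
  unfold Rdiv. rewrite Rabs_mult, pow_1_abs, Rmult_1_l, Rabs_pos_eq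
    by (left; apply Rinv_0_lt_compat, pow_lt, INR_S_pos).
  apply Rinv_le_contravar; [apply INR_S_pos|].
  assert (1 <= INR (S n)) by (apply (le_INR 1); lia). nra.
Qed.

Lemma H2_bound n : Rabs (H2 n) <= H n.
Proof.
  unfold H2. induction n as [|n IH]; [simpl; rewrite Rabs_R0, H_0; lra|].
  cbn [psum]. rewrite H_S. eapply Rle_trans; [apply Rabs_triang|].
  apply Rplus_le_compat; [exact IH|].
  rewrite Rabs_pos_eq by (left; apply Rinv_0_lt_compat, pow_lt, INR_S_pos).
  apply Rinv_le_contravar; [apply INR_S_pos|].
  assert (1 <= INR (S n)) by (apply (le_INR 1); lia). nra.
Qed.

Lemma Rabs_sg_mult n x : Rabs (sg n * x) = Rabs x.
Proof. rewrite Rabs_mult, Rabs_sg. ring. Qed.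

Ltac bounded C :=
  exists C; intros n Hn; pose proof (H_sq_ge_1 n Hn);
  pose proof (L_bound n); pose proof (L_2_bound n); pose proof (H2_bound n);
  pose proof (Rabs_pos (L n 1));
  rewrite ?Rabs_sg_mult, ?Rabs_sg, ?Rabs_R1, ?(Rabs_pos_eq (H n) (H_nonneg n)),
    ?(Rabs_pos_eq (H n ^ 2)) by lra;
  rewrite <- ?RPow_abs; nra.

Lemma is_sum_Dir_one i : (2 <= i)%nat ->
  is_sum (fun n => 1 / INR n ^ i)
    (Dir (fun _ => 1) i).
Proof.
  intros Hi. apply (is_sum_Dir (fun n => 1)); [easy|bounded 1].
Qed.

Lemma is_sum_Dir_sg i : (2 <= i)%nat ->
  is_sum (fun n => sg n / INR n ^ i)
    (Dir sg i).
Proof.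
  intros Hi. apply (is_sum_Dir (fun n => sg n)); [easy|bounded 1].
Qed.

Lemma is_sum_Dir_L i : (2 <= i)%nat ->
  is_sum (fun n => L n 1 / INR n ^ i)
    (Dir (fun n => L n 1) i).
Proof.
  intros Hi. apply (is_sum_Dir (fun n => L n 1)); [easy|bounded 3].
Qed.

Lemma is_sum_Dir_sgL i : (2 <= i)%nat ->
  is_sum (fun n => sg n * L n 1 / INR n ^ i)
    (Dir (fun n => sg n * L n 1) i).
Proof.
  intros Hi. apply (is_sum_Dir (fun n => sg n * L n 1)); [easy|bounded 3].
Qed.

Lemma is_sum_Dir_sgH i : (2 <= i)%nat ->
  is_sum (fun n => sg n * H n / INR n ^ i)
    (Dir (fun n => sg n * H n) i).
Proof.
  intros Hi. apply (is_sum_Dir (fun n => sg n * H n)); [easy|bounded 1].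
Qed.

Lemma is_sum_Dir_sgL2 i : (2 <= i)%nat ->
  is_sum (fun n => sg n * L n 2 / INR n ^ i)
    (Dir (fun n => sg n * L n 2) i).
Proof.
  intros Hi. apply (is_sum_Dir (fun n => sg n * L n 2)); [easy|bounded 1].
Qed.

Lemma is_sum_Dir_sgH2 i : (2 <= i)%nat ->
  is_sum (fun n => sg n * H2 n / INR n ^ i)
    (Dir (fun n => sg n * H2 n) i).
Proof.
  intros Hi. apply (is_sum_Dir (fun n => sg n * H2 n)); [easy|bounded 1].
Qed.

Lemma is_sum_Dir_sgLsq i : (2 <= i)%nat ->
  is_sum (fun n => sg n * L n 1 ^ 2 / INR n ^ i)
    (Dir (fun n => sg n * L n 1 ^ 2) i).
Proof.
  intros Hi. apply (is_sum_Dir (fun n => sg n * L n 1 ^ 2)); [easy|bounded 9].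
Qed.

Lemma is_sum_Dir_sgHsq i : (2 <= i)%nat ->
  is_sum (fun n => sg n * H n ^ 2 / INR n ^ i)
    (Dir (fun n => sg n * H n ^ 2) i).
Proof.
  intros Hi. apply (is_sum_Dir (fun n => sg n * H n ^ 2)); [easy|bounded 1].
Qed.

Lemma Series1_ext f g :
  (forall n, (1 <= n)%nat -> f n = g n) -> Series1 f = Series1 g.
Proof. intros E. apply Series_ext. intros n. apply E. lia. Qed.

Lemma L_pred n : (1 <= n)%nat -> L (n - 1) 1 = L n 1 - sg n / INR n.
Proof.
  intros Hn. destruct n as [|n]; [lia|]. rewrite L_1_S.
  replace (S n - 1)%nat with n by lia. unfold sg. simpl. unfold Rdiv. ring.
Qed.

(** The case u = m, v = n, a = [L], b = [sg]. Besides the -1/2 from the kernel sum over m, the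
    square arises on the right: the kernel sum over n contains sg_m L_(m-1), and it is multiplied by
    L_m. *)
Lemma alternating_square_relation k :
  ln 2 * (Dir (fun n => sg n * L n 1) (k + 2) + Dir (fun n => sg n * H n) (k + 2))
  - Dir (fun n => sg n * L n 2) (k + 2)
  - / 2 * (Dir (fun n => sg n * L n 1 ^ 2) (k + 2) - Dir (fun n => sg n * H2 n) (k + 2))
  = INR (k + 2) * Dir (fun n => sg n * L n 1) (k + 3)
    + (Dir (fun n => sg n * L n 1 ^ 2) (k + 2) - ln 2 * Dir (fun n => sg n * L n 1) (k + 2)
       - Dir (fun n => L n 1) (k + 3) - ln 2 * Dir (fun n => L n 1) (k + 2))
    - psum (fun i => Dir (fun n => L n 1) (S i) * Dir sg (k + 2 - i)) k.
Proof.
  assert (K : is_sum (fun n => sg n * / (1 * INR n) ^ (k + 2)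
      * (ln 2 * (L n 1 + H n) - L n 2 - / 2 * (L n 1 ^ 2 - H2 n)))
    ((1 + 1) / 2 * INR (k + 2) * Series1 (fun m => L m 1 * sg m / INR m ^ (k + 3))
     + Series1 (fun m => L m 1 * ((-1) ^ m * (ln 2 - L (m - 1) 1) - ln 2) / INR m ^ (k + 2))
     - psum (fun i => Series1 (fun m => L m 1 / INR m ^ S i)
                 * (1 ^ (k + 2 - i)
                    * Series1 (fun n => sg n / INR n ^ (k + 2 - i)))) k)).
  (* 12 = 4 * 3: a truncated kernel sum is a signed combination of four values of [L], each at most
     3. *)
  { apply (is_sum_product_kernel 1 12); [now left| | | | |].
    - intros m Hm. pose proof (L_bound m). pose proof (H_ge_1 m Hm). lra.
    - intros n _. rewrite Rabs_sg. lra.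
    - intros N m Hm.
      rewrite (psum_ext _ (fun n => sg n / (INR n - INR m) - sg n / INR n))
        by (intros; rewrite Rmult_1_l; unfold Rdiv; ring).
      rewrite psum_minus, psum_sg_down, psum_sg_L by easy.
      pose proof (H_ge_1 m Hm).
      pose proof (Rabs_le_between (L (N - m) 1) 3) as [B1 _].
      pose proof (Rabs_le_between (L (m - 1 - N) 1) 3) as [B2 _].
      pose proof (Rabs_le_between (L (m - 1) 1) 3) as [B3 _].
      pose proof (Rabs_le_between (L N 1) 3) as [B4 _].
      specialize (B1 (L_bound _)). specialize (B2 (L_bound _)).
      specialize (B3 (L_bound _)). specialize (B4 (L_bound _)).
      apply Rabs_le. destruct (sg_cases m) as [[_ ->] | [_ ->]]; lra.
    - intros m Hm. eapply is_sum_ext;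
        [|apply is_sum_minus; [now apply is_sum_sg_down|apply is_sum_sg_inv]].
      intros n _. cbv beta. rewrite Rmult_1_l. unfold Rdiv. ring.
    - intros n _. eapply is_sum_ext; [|apply is_sum_L_kernel].
      intros m _. now rewrite Rmult_1_l. }
  eapply is_sum_unique.
  { eapply is_sum_ext;
      [|apply is_sum_minus; [apply is_sum_minus; [apply is_sum_scal, is_sum_plus|]
                            |apply is_sum_scal, is_sum_minus]].
    2: apply is_sum_Dir_sgL; lia. 2: apply is_sum_Dir_sgH; lia. 2: apply is_sum_Dir_sgL2; lia.
    2: apply is_sum_Dir_sgLsq; lia. 2: apply is_sum_Dir_sgH2; lia.
    intros n _. cbv beta. reflexivity. }
  eapply is_sum_ext; [|eapply eq_rect; [exact K|]].
  { intros n _. cbv beta. rewrite Rmult_1_l. unfold Rdiv. ring. }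
  assert (E1 : Series1 (fun m => L m 1 * sg m / INR m ^ (k + 3))
               = Dir (fun n => sg n * L n 1) (k + 3)).
  { apply Series1_ext. intros; unfold Rdiv; ring. }
  assert (E2 : Series1 (fun m => L m 1 * ((-1) ^ m * (ln 2 - L (m - 1) 1) - ln 2) / INR m ^ (k + 2))
     = Dir (fun n => sg n * L n 1 ^ 2) (k + 2) - ln 2 * Dir (fun n => sg n * L n 1) (k + 2)
       - Dir (fun n => L n 1) (k + 3) - ln 2 * Dir (fun n => L n 1) (k + 2)).
  { apply Series1_is_sum. eapply is_sum_ext;
      [|apply is_sum_minus; [apply is_sum_minus; [apply is_sum_minus;
          [|apply is_sum_scal]|]|apply is_sum_scal]].
    2: apply is_sum_Dir_sgLsq; lia. 2: apply is_sum_Dir_sgL; lia.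
    2: apply is_sum_Dir_L; lia. 2: apply is_sum_Dir_L; lia.
    intros m Hm. cbv beta. rewrite L_pred, pow_m1_sg by easy.
    pose proof (INR_gt_0 m Hm).
    replace (k + 3)%nat with (S (k + 2)) by lia. cbn [pow].
    pose proof (pow_lt (INR m) (k + 2) ltac:(easy)).
    destruct (sg_cases m) as [[-> _] | [-> _]]; field; lra. }
  rewrite E1, E2.
  rewrite (psum_ext _ (fun i => Dir (fun n => L n 1) (S i) * Dir sg (k + 2 - i)))
    by (intros; rewrite pow1; unfold Dir; ring).
  field.
Qed.

Lemma Rinv_neg_mult x y : / (-1 * x - y) = - / (x + y).
Proof. replace (-1 * x - y) with (- (x + y)) by ring. apply Rinv_opp. Qed.

Lemma Rinv_neg1_mult x : / (-1 * x) = - / x.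
Proof. replace (-1 * x) with (- x) by ring. apply Rinv_opp. Qed.

Lemma Rinv_neg1_mult_pow x i : / (-1 * x) ^ i = (-1) ^ i * / x ^ i.
Proof.
  rewrite Rpow_mult_distr, Rinv_mult, <- pow_inv. f_equal. f_equal. field.
Qed.

Lemma psum_H_up m N :
  psum (fun n => 1 * (/ (-1 * INR n - INR m) - / (-1 * INR n))) N
  = H m - (H (N + m) - H N).
Proof.
  rewrite (psum_ext _ (fun n => 1 ^ S n / INR n - 1 ^ S n / (INR n + INR m))).
  - rewrite psum_minus, psum_shift_up, !psum_inv_H, pow1 by now left. ring.
  - intros n _. rewrite Rinv_neg_mult, Rinv_neg1_mult, pow1. unfold Rdiv. ring.
Qed.

Lemma psum_H_up_bound m N :
  Rabs (psum (fun n => 1 * (/ (-1 * INR n - INR m) - / (-1 * INR n))) N) <= H m.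
Proof.
  rewrite psum_H_up. pose proof (H_subadditive m N). pose proof (H_le N (N + m) ltac:(lia)).
  pose proof (H_nonneg m). apply Rabs_le. lra.
Qed.

Lemma is_sum_H_up m :
  is_sum (fun n => 1 * (/ (-1 * INR n - INR m) - / (-1 * INR n))) (H m).
Proof.
  eapply is_lim_seq_ext; [intros N; symmetry; apply psum_H_up|].
  replace (Finite (H m)) with (Finite (H m - 0)) by (f_equal; ring).
  apply is_lim_seq_minus'; [apply is_lim_seq_const|].
  eapply is_lim_seq_ext; [|apply (H_shift_lim m)].
  intros N. simpl. now rewrite Nat.add_comm.
Qed.

Lemma psum_H_down m N : (1 <= m)%nat ->
  psum (fun n => 1 * (/ (1 * INR n - INR m) - / (1 * INR n))) N
  = H (N - m) + H (m - 1 - N) - H (m - 1) - H N.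
Proof.
  intros Hm.
  rewrite (psum_ext _ (fun n => 1 ^ S n / (INR n - INR m) - 1 ^ S n / INR n)).
  - rewrite psum_minus, psum_shift_down, !psum_inv_H, pow1 by (easy || now left). ring.
  - intros n _. rewrite pow1, !Rmult_1_l. unfold Rdiv. ring.
Qed.

(** H_N is unbounded, so uniformity in N rests on pairing it with H_(N-m): by subadditivity they
    differ by at most H_m. For N < m every term is already at most H_m. *)
Lemma psum_H_down_bound m N : (1 <= m)%nat ->
  Rabs (psum (fun n => 1 * (/ (1 * INR n - INR m) - / (1 * INR n))) N) <= 3 * H m.
Proof.
  intros Hm. rewrite psum_H_down by easy.
  pose proof (H_le (m - 1) m ltac:(lia)). pose proof (H_nonneg (m - 1)).
  destruct (Nat.le_gt_cases m N) as [C | C].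
  - replace (m - 1 - N)%nat with 0%nat by lia. rewrite H_0.
    pose proof (H_subadditive m (N - m)). pose proof (H_le (N - m) N ltac:(lia)).
    replace (N - m + m)%nat with N in * by lia. apply Rabs_le. lra.
  - replace (N - m)%nat with 0%nat by lia. rewrite H_0.
    pose proof (H_le N m ltac:(lia)). pose proof (H_le (m - 1 - N) m ltac:(lia)).
    pose proof (H_nonneg N). pose proof (H_nonneg (m - 1 - N)). apply Rabs_le. lra.
Qed.

Lemma is_sum_H_down m : (1 <= m)%nat ->
  is_sum (fun n => 1 * (/ (1 * INR n - INR m) - / (1 * INR n))) (- H (m - 1)).
Proof.
  intros Hm. eapply is_lim_seq_ext; [intros N; symmetry; now apply psum_H_down|].
  apply (is_lim_seq_ext (fun N => H (m - 1 - N) - H (m - 1) - (H N - H (N - m))));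
    [intros; ring|].
  replace (Finite (- H (m - 1))) with (Finite (H 0 - H (m - 1) - 0))
    by (f_equal; rewrite H_0; ring).
  apply is_lim_seq_minus'; [apply is_lim_seq_minus'|].
  - apply is_lim_seq_sub_l.
  - apply is_lim_seq_const.
  - apply (is_lim_seq_incr_n _ m). eapply is_lim_seq_ext; [|apply (H_shift_lim m)].
    intros N. simpl. rewrite Nat.add_comm. do 2 f_equal. lia.
Qed.

Lemma sg_H_bound C m : 1 <= C -> (1 <= m)%nat -> Rabs (sg m * H m) <= C * H m.
Proof.
  intros HC Hm. rewrite Rabs_sg_mult, Rabs_pos_eq by apply H_nonneg.
  pose proof (H_ge_1 m Hm). nra.
Qed.

(** The case u = m, v = -n, a = [sg], b = 1, one exponent higher than the other relations. Its left
    side occurs inside [quadratic_relation]; here it is exchanged for products of zeta values and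
    one Euler sum. *)
Lemma linear_relation k :
  ln 2 * (Dir (fun _ => 1) (k + 3) + Dir sg (k + 3)) - Dir (fun n => sg n * L n 1) (k + 3)
  = (-1) ^ (k + 3) * Dir (fun n => sg n * H n) (k + 3)
    - psum (fun i => (-1) ^ i * Dir sg (S i) * Dir (fun _ => 1) (k + 3 - i)) (S k).
Proof.
  assert (K : is_sum (fun n => 1 * / (-1 * INR n) ^ (S k + 2)
      * (ln 2 - (-1) ^ n * (ln 2 - L n 1)))
    ((1 + -1) / 2 * INR (S k + 2) * Series1 (fun m => sg m * 1 / INR m ^ (S k + 3))
     + Series1 (fun m => sg m * H m / INR m ^ (S k + 2))
     - psum (fun i => Series1 (fun m => sg m / INR m ^ S i)
                 * ((-1) ^ (S k + 2 - i)
                    * Series1 (fun n => 1 / INR n ^ (S k + 2 - i)))) (S k))).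
  { apply (is_sum_product_kernel (-1) 1 sg (fun _ => 1) H); [now right| | | | |].
    - intros m Hm. rewrite Rabs_sg. pose proof (H_ge_1 m Hm). lra.
    - intros n _. rewrite Rabs_R1. lra.
    - intros N m Hm. rewrite Rmult_1_l. apply psum_H_up_bound.
    - intros m Hm. apply is_sum_H_up.
    - intros n _. eapply is_sum_ext;
        [|apply is_sum_minus; [apply is_sum_sg_inv|apply (is_sum_sg_up n)]].
      intros m _. cbv beta. replace (INR m - -1 * INR n) with (INR m + INR n) by ring.
      unfold Rdiv. ring. }
  replace (S k + 2)%nat with (k + 3)%nat in K by lia.
  (* Clears the sign of (-n)^(k+3). *)
  apply (is_sum_scal ((-1) ^ (k + 3))) in K.
  eapply is_sum_unique.
  { eapply is_sum_ext; [|apply is_sum_minus; [apply is_sum_scal, is_sum_plus|]].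
    2: apply is_sum_Dir_one; lia. 2: apply is_sum_Dir_sg; lia. 2: apply is_sum_Dir_sgL; lia.
    intros n _. cbv beta. reflexivity. }
  eapply is_sum_ext; [|eapply eq_rect; [exact K|]].
  { intros n _. cbv beta. rewrite Rinv_neg1_mult_pow, (pow_m1_sg n).
    rewrite Rmult_1_l, <- !Rmult_assoc, pow_m1_sq. unfold Rdiv. ring. }
  rewrite Rmult_minus_distr_l, <- psum_scal.
  rewrite (psum_ext _ (fun i => (-1) ^ i * Dir sg (S i) * Dir (fun _ => 1) (k + 3 - i))).
  - unfold Dir. unfold Rdiv. ring.
  - intros i Hi. cbv beta.
    assert (E : (-1) ^ (k + 3) * (-1) ^ (k + 3 - i) = (-1) ^ i).
    { replace (k + 3)%nat with (i + (k + 3 - i))%nat at 1 by lia.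
      rewrite pow_add, Rmult_assoc, pow_m1_sq. ring. }
    rewrite <- E. unfold Dir. ring.
Qed.

(** The difference has absolute value n / (m |m - s n|). Where m - s n is nonzero it is an integer,
    so m <= (n + 1) |m - s n| and the decay is quadratic in m for fixed n. *)
Lemma kernel_difference_bound s n m : s = 1 \/ s = -1 -> (1 <= n)%nat -> (1 <= m)%nat ->
  Rabs (/ INR m - / (INR m - s * INR n)) <= INR n * (INR n + 1) * / INR m ^ 2.
Proof.
  intros Hs Hn Hm. pose proof (INR_gt_0 m Hm) as Pm.
  assert (Pn : 1 <= INR n) by now apply (le_INR 1).
  destruct (Req_dec (INR m - s * INR n) 0) as [E | E].
  - assert (Emn : INR m = INR n) by (destruct Hs as [-> | ->]; lra).
    rewrite E, Rinv_0, Rminus_0_r, Rabs_pos_eq by (left; apply Rinv_0_lt_compat, Pm).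
    rewrite Emn. apply (Rmult_le_reg_r (INR n ^ 2)); [nra|]. field_simplify; nra.
  - replace (/ INR m - / (INR m - s * INR n))
      with (- (s * INR n) * / (INR m * (INR m - s * INR n))) by (field; lra).
    assert (D : INR m <= (INR n + 1) * Rabs (INR m - s * INR n)).
    { destruct Hs as [-> | ->].
      - rewrite Rmult_1_l in *.
        destruct (Nat.lt_trichotomy m n) as [C | [C | C]].
        + assert (INR m + 1 <= INR n) by (rewrite <- S_INR; apply le_INR; lia).
          rewrite Rabs_left by lra. nra.
        + subst; lra.
        + assert (INR n + 1 <= INR m) by (rewrite <- S_INR; apply le_INR; lia).
          rewrite Rabs_pos_eq by lra. nra.
      - rewrite Rabs_pos_eq by lra. nra. }
    assert (P : 0 < Rabs (INR m - s * INR n)) by now apply Rabs_pos_lt.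
    rewrite Rabs_mult, Rabs_Ropp, Rabs_mult, Rabs_inv, Rabs_mult.
    rewrite (Rabs_pos_eq (INR n)), (Rabs_pos_eq (INR m)) by lra.
    replace (Rabs s) with 1 by (destruct Hs as [-> | ->];
      [now rewrite Rabs_R1|rewrite Rabs_left; lra]).
    set (y := Rabs (INR m - s * INR n)) in *.
    apply (Rmult_le_reg_r (INR m ^ 2 * y)); [apply Rmult_lt_0_compat; nra|].
    replace (1 * INR n * / (INR m * y) * (INR m ^ 2 * y)) with (INR n * INR m)
      by (field; lra).
    replace (INR n * (INR n + 1) * / INR m ^ 2 * (INR m ^ 2 * y))
      with (INR n * ((INR n + 1) * y)) by (field; lra).
    apply Rmult_le_compat_l; lra.
Qed.

(** Kept as an unevaluated series: [quadratic_relation] combines the two signs so that only their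
    difference remains, which has a closed form. *)
Definition sg_H_kernel_sum (s : R) (n : nat) : R :=
  Series1 (fun m => sg m * H m * (/ INR m - / (INR m - s * INR n))).

Lemma is_sum_sg_H_kernel_sum s n : s = 1 \/ s = -1 -> (1 <= n)%nat ->
  is_sum (fun m => sg m * H m * (/ INR m - / (INR m - s * INR n))) (sg_H_kernel_sum s n).
Proof.
  intros Hs Hn. apply (is_sum_dominated _ (INR n * (INR n + 1))).
  intros m Hm. rewrite Rmult_assoc, Rabs_sg_mult, Rabs_mult.
  rewrite (Rabs_pos_eq (H m)) by apply H_nonneg.
  replace (INR n * (INR n + 1) * (H m ^ 2 / INR m ^ 2))
    with (H m ^ 2 * (INR n * (INR n + 1) * / INR m ^ 2)) by (unfold Rdiv; ring).
  apply Rmult_le_compat; [apply H_nonneg|apply Rabs_pos| |].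
  - now apply H_sq_ge_1.
  - now apply kernel_difference_bound.
Qed.

Lemma sg_H_kernel_difference n : (1 <= n)%nat ->
  sg_H_kernel_sum 1 n - sg_H_kernel_sum (-1) n =
  sg n * (Dir sg 2 - H2 n + L n 2 + ((1 + sg n) * ln 2 - L n 1) / INR n).
Proof.
  intros Hn.
  pose proof (is_sum_scal (-1) _ _ (is_sum_sg_H_kernel n Hn)) as A.
  pose proof (is_sum_minus _ _ _ _ (is_sum_sg_H_kernel_sum 1 n (or_introl eq_refl) Hn)
                                   (is_sum_sg_H_kernel_sum (-1) n (or_intror eq_refl) Hn)) as B.
  transitivity (-1 * ((-1) ^ n * (Series1 (fun m => sg m / INR m ^ 2) - H2 n + L n 2
                 + ((1 - (-1) ^ n) * ln 2 - L n 1) / INR n))).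
  - apply (is_sum_unique _ _ _ B).
    eapply is_sum_ext; [|exact A]. intros m _. cbv beta.
    replace (INR m - -1 * INR n) with (INR m + INR n) by ring.
    rewrite Rmult_1_l. ring.
  - rewrite pow_m1_sg. unfold Dir, Rdiv. ring.
Qed.

(** The cases v = n and v = -n for a_m = sg_m H_m, b = 1. The kernel sums over n are -H_(m-1) and
    H_m: they supply the squares, and H_(m-1) = H_m - 1/m adds one to the diagonal coefficient k +
    2. *)
Lemma quadratic_relation k :
  Dir sg 2 * Dir sg (k + 2) - Dir (fun n => sg n * H2 n) (k + 2)
  + Dir (fun n => sg n * L n 2) (k + 2)
  + ln 2 * (Dir sg (k + 3) + Dir (fun _ => 1) (k + 3))
  - Dir (fun n => sg n * L n 1) (k + 3)
  = (INR (k + 2) + 1) * Dir (fun n => sg n * H n) (k + 3)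
    - (1 + (-1) ^ k) * Dir (fun n => sg n * H n ^ 2) (k + 2)
    - psum (fun i => (1 - (-1) ^ i) * Dir (fun n => sg n * H n) (S i)
                      * Dir (fun _ => 1) (k + 2 - i)) k.
Proof.
  assert (K1 : is_sum (fun n => 1 * / (1 * INR n) ^ (k + 2) * sg_H_kernel_sum 1 n)
    ((1 + 1) / 2 * INR (k + 2) * Series1 (fun m => sg m * H m * 1 / INR m ^ (k + 3))
     + Series1 (fun m => sg m * H m * (- H (m - 1)) / INR m ^ (k + 2))
     - psum (fun i => Series1 (fun m => sg m * H m / INR m ^ S i)
                 * (1 ^ (k + 2 - i)
                    * Series1 (fun n => 1 / INR n ^ (k + 2 - i)))) k)).
  { apply (is_sum_product_kernel 1 3 (fun m => sg m * H m) (fun _ => 1)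
             (fun m => - H (m - 1)) (sg_H_kernel_sum 1)); [now left| | | | |].
    - intros m Hm. apply sg_H_bound; [lra|easy].
    - intros n _. rewrite Rabs_R1. lra.
    - intros N m Hm. now apply psum_H_down_bound.
    - intros m Hm. now apply is_sum_H_down.
    - intros n Hn. apply is_sum_sg_H_kernel_sum; [now left|easy]. }
  assert (K2 : is_sum (fun n => 1 * / (-1 * INR n) ^ (k + 2) * sg_H_kernel_sum (-1) n)
    ((1 + -1) / 2 * INR (k + 2) * Series1 (fun m => sg m * H m * 1 / INR m ^ (k + 3))
     + Series1 (fun m => sg m * H m * H m / INR m ^ (k + 2))
     - psum (fun i => Series1 (fun m => sg m * H m / INR m ^ S i)
                 * ((-1) ^ (k + 2 - i)
                    * Series1 (fun n => 1 / INR n ^ (k + 2 - i)))) k)).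
  { apply (is_sum_product_kernel (-1) 1 (fun m => sg m * H m) (fun _ => 1)
             H (sg_H_kernel_sum (-1))); [now right| | | | |].
    - intros m Hm. apply sg_H_bound; [lra|easy].
    - intros n _. rewrite Rabs_R1. lra.
    - intros N m Hm. rewrite Rmult_1_l. apply psum_H_up_bound.
    - intros m Hm. apply is_sum_H_up.
    - intros n Hn. apply is_sum_sg_H_kernel_sum; [now right|easy]. }
  (* With this factor (-n)^(k+2) becomes n^(k+2), so subtraction leaves the difference of the two
     kernel sums over m. *)
  apply (is_sum_scal ((-1) ^ k)) in K2.
  pose proof (is_sum_minus _ _ _ _ K1 K2) as K.
  eapply is_sum_unique.
  { eapply is_sum_ext; [|apply is_sum_minus; [apply is_sum_plus; [apply is_sum_plus;
      [apply is_sum_minus; [apply is_sum_scal|]|]|apply is_sum_scal, is_sum_plus]|]].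
    2: apply is_sum_Dir_sg; lia. 2: apply is_sum_Dir_sgH2; lia. 2: apply is_sum_Dir_sgL2; lia.
    2: apply is_sum_Dir_sg; lia. 2: apply is_sum_Dir_one; lia. 2: apply is_sum_Dir_sgL; lia.
    intros n _. cbv beta. reflexivity. }
  eapply is_sum_ext; [|eapply eq_rect; [exact K|]].
  { intros n Hn. cbv beta. rewrite Rinv_neg1_mult_pow, (pow_add (-1)).
    pose proof (sg_H_kernel_difference n Hn) as E. pose proof (pow_m1_sq k) as Pk.
    replace ((-1) ^ k * (1 * ((-1) ^ k * (-1) ^ 2 * / INR n ^ (k + 2)) * sg_H_kernel_sum (-1) n))
      with (((-1) ^ k * (-1) ^ k) * (/ INR n ^ (k + 2) * sg_H_kernel_sum (-1) n)) by ring.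
    rewrite Pk, !Rmult_1_l, <- Rmult_minus_distr_l, E.
    pose proof (INR_gt_0 n Hn).
    replace (k + 3)%nat with (S (k + 2)) by lia. cbn [pow].
    pose proof (pow_lt (INR n) (k + 2) ltac:(easy)).
    destruct (sg_cases n) as [[-> _] | [-> _]]; field; lra. }
  assert (E1 : Series1 (fun m => sg m * H m * (- H (m - 1)) / INR m ^ (k + 2))
     = Dir (fun n => sg n * H n) (k + 3) - Dir (fun n => sg n * H n ^ 2) (k + 2)).
  { apply Series1_is_sum. eapply is_sum_ext; [|apply is_sum_minus].
    2: apply is_sum_Dir_sgH; lia. 2: apply is_sum_Dir_sgHsq; lia.
    intros m Hm. cbv beta. destruct m as [|m]; [lia|].
    replace (S m - 1)%nat with m by lia. replace (H m) with (H (S m) - / INR (S m))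
      by (rewrite H_S; ring).
    pose proof (INR_S_pos m).
    replace (k + 3)%nat with (S (k + 2)) by lia. cbn [pow].
    pose proof (pow_lt (INR (S m)) (k + 2) ltac:(easy)). field; lra. }
  assert (E2 : Series1 (fun m => sg m * H m * H m / INR m ^ (k + 2))
     = Dir (fun n => sg n * H n ^ 2) (k + 2)).
  { apply Series1_ext. intros. unfold Rdiv. ring. }
  assert (E3 : Series1 (fun m => sg m * H m * 1 / INR m ^ (k + 3))
     = Dir (fun n => sg n * H n) (k + 3)).
  { apply Series1_ext. intros. unfold Rdiv. ring. }
  rewrite E1, E2, E3.
  rewrite (psum_ext (fun i => (1 - (-1) ^ i) * Dir (fun n => sg n * H n) (S i)
                      * Dir (fun _ => 1) (k + 2 - i))
    (fun i => Series1 (fun m => sg m * H m / INR m ^ S i)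
                 * (1 ^ (k + 2 - i)
                    * Series1 (fun n => 1 / INR n ^ (k + 2 - i)))
       - (-1) ^ k * (Series1 (fun m => sg m * H m / INR m ^ S i)
                 * ((-1) ^ (k + 2 - i)
                    * Series1 (fun n => 1 / INR n ^ (k + 2 - i)))))).
  - rewrite psum_minus, psum_scal. field.
  - intros i Hi. unfold Dir. rewrite pow1.
    assert (E : (-1) ^ k * (-1) ^ (k + 2 - i) = (-1) ^ i).
    { replace (k + 2 - i)%nat with (2 + (k - i))%nat by lia.
      replace k with (i + (k - i))%nat at 1 by lia.
      rewrite !pow_add. rewrite Rmult_assoc, (Rmult_comm ((-1) ^ (k - i))).
      rewrite (Rmult_assoc ((-1) ^ 2)), pow_m1_sq. ring. }
    rewrite <- E. ring.
Qed.

(** * Translation to zeta values *)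

(** Twice the even-indexed terms up to 2N is 2/4 of the plain sum up to N. *)
Lemma psum_sg_square N :
  psum (fun n => sg n / INR n ^ 2) (N + N)
  = psum (fun n => 1 / INR n ^ 2) (N + N) - / 2 * psum (fun n => 1 / INR n ^ 2) N.
Proof.
  induction N as [|N IH]; [simpl; ring|].
  replace (S N + S N)%nat with (S (S (N + N))) by lia.
  cbn [psum]. rewrite IH, !sg_S.
  assert (sg (N + N) = -1) as ->.
  { unfold sg. simpl. rewrite pow_add, pow_m1_sq. ring. }
  rewrite !S_INR, plus_INR. pose proof (pos_INR N). field. lra.
Qed.

(** Both series are known to converge, so comparing them along even partial sums suffices. *)
Lemma Dir_sg_2 : Dir sg 2 = / 2 * Dir (fun _ => 1) 2.
Proof.
  pose proof (is_sum_Dir_sg 2 (le_n 2)) as A. pose proof (is_sum_Dir_one 2 (le_n 2)) as B.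
  assert (F : filterlim (fun N => (N + N)%nat) eventually eventually).
  { apply eventually_subseq. intros n. lia. }
  assert (A' := is_lim_seq_subseq _ _ _ F A).
  assert (B' := is_lim_seq_subseq _ _ _ F B).
  assert (C' : is_lim_seq (fun N => psum (fun n => sg n / INR n ^ 2) (N + N))
                 (Dir (fun _ => 1) 2 - / 2 * Dir (fun _ => 1) 2)).
  { eapply is_lim_seq_ext; [intros N; symmetry; apply psum_sg_square|].
    apply is_lim_seq_minus'; [exact B'|].
    apply (is_lim_seq_scal_l _ (/ 2) _ B). }
  apply is_lim_seq_unique in A', C'. rewrite A' in C'. injection C'. lra.
Qed.

Lemma pow_m1_pred n : (1 <= n)%nat -> (-1) ^ (n - 1) = sg n.
Proof.
  intros Hn. destruct n as [|n]; [lia|]. replace (S n - 1)%nat with n by lia.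
  unfold sg. simpl. ring.
Qed.

Lemma zeta_Dir i : zeta i = Dir (fun _ => 1) i.
Proof. apply Series1_ext. intros; unfold Rdiv; ring. Qed.

Lemma zeta_bar_Dir i : zeta_bar i = Dir sg i.
Proof. apply Series1_ext. intros n Hn. now rewrite pow_m1_pred. Qed.

Lemma Dir_scal c f i : Dir (fun n => c * f n) i = c * Dir f i.
Proof.
  unfold Dir, Series1. rewrite <- Series_scal_l. apply Series_ext.
  intros n. unfold Rdiv. ring.
Qed.

(** Each bar contributes a minus sign, as (-1)^n = - sg n; two bars therefore give a plus sign. *)
Lemma zeta_star_Bar i j :
  zeta_star [Bar i; j] = - Dir (fun n => sg n * zeta_star_upto [j] n) i.
Proof.
  rewrite <- (Rmult_1_l (Dir _ _)), Ropp_mult_distr_l, <- Dir_scal.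
  apply Series1_ext. intros n _. cbn [zterm]. rewrite pow_m1_sg. unfold Rdiv. ring.
Qed.

Lemma zeta_star_Plain i j :
  zeta_star [Plain i; j] = Dir (fun n => zeta_star_upto [j] n) i.
Proof. apply Series1_ext. intros n _. cbn [zterm]. unfold Rdiv. ring. Qed.

Lemma upto_Bar_1 n : zeta_star_upto [Bar 1] n = - L n 1.
Proof.
  cbn [zeta_star_upto zterm]. rewrite sum_n_m_psum.
  rewrite <- psum_sg_L, <- (Rmult_1_l (psum (fun j => sg j / INR j) n)),
    Ropp_mult_distr_l, <- psum_scal.
  apply psum_ext. intros m _. rewrite pow_1, pow_m1_sg. unfold Rdiv. ring.
Qed.

Lemma upto_Plain_1 n : zeta_star_upto [Plain 1] n = H n.
Proof.
  cbn [zeta_star_upto zterm]. unfold H. rewrite !sum_n_m_psum.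
  apply psum_ext. intros m _. rewrite pow_1. unfold Rdiv. ring.
Qed.

Lemma upto_Plain_2 n : zeta_star_upto [Plain 2] n = H2 n.
Proof.
  cbn [zeta_star_upto zterm]. rewrite sum_n_m_psum.
  apply psum_ext. intros m _. unfold Rdiv. ring.
Qed.

Lemma Dir_ext f g i : (forall n, f n = g n) -> Dir f i = Dir g i.
Proof. intros E. apply Series1_ext. intros n _. now rewrite E. Qed.

Lemma zeta_star_Bar_Bar_1 i : zeta_star [Bar i; Bar 1] = Dir (fun n => sg n * L n 1) i.
Proof.
  rewrite zeta_star_Bar, <- (Rmult_1_l (Dir _ _)), Ropp_mult_distr_l, <- Dir_scal.
  apply Dir_ext. intros n. rewrite upto_Bar_1. ring.
Qed.

Lemma zeta_star_Bar_Plain_1 i : zeta_star [Bar i; Plain 1] = - Dir (fun n => sg n * H n) i.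
Proof.
  rewrite zeta_star_Bar. f_equal. apply Dir_ext. intros n. now rewrite upto_Plain_1.
Qed.

Lemma zeta_star_Bar_Plain_2 i : zeta_star [Bar i; Plain 2] = - Dir (fun n => sg n * H2 n) i.
Proof.
  rewrite zeta_star_Bar. f_equal. apply Dir_ext. intros n. now rewrite upto_Plain_2.
Qed.

Lemma zeta_star_Plain_Bar_1 i : zeta_star [Plain i; Bar 1] = - Dir (fun n => L n 1) i.
Proof.
  rewrite zeta_star_Plain, <- (Rmult_1_l (Dir (fun n => L n 1) i)),
    Ropp_mult_distr_l, <- Dir_scal.
  apply Dir_ext. intros n. rewrite upto_Bar_1. ring.
Qed.

Lemma sum_n_m_from_2 f N M : N = S M -> sum_n_m f 2 N = psum (fun i => f (S i)) M.
Proof. intros ->. now rewrite <- sum_n_m_S, sum_n_m_psum. Qed.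

Lemma Dir_sg_1 : Dir sg 1 = ln 2.
Proof.
  apply Series1_is_sum. eapply is_sum_ext; [|apply is_sum_sg_inv].
  intros n _. cbv beta. now rewrite pow_1.
Qed.

Theorem theorem3p2 : forall p : nat, (1 <= p)%nat ->
  3 / 2 * Series1 (fun n => (L n 1) ^ 2 / INR n ^ (p + 1) * (-1) ^ (n - 1))
  - (1 + (-1) ^ (p - 1))
    * Series1 (fun n => (H n) ^ 2 / INR n ^ (p + 1) * (-1) ^ (n - 1))
  =
  ln 2 * (zeta_star [Bar (p + 1); Bar 1] - zeta_star [Bar (p + 1); Plain 1])
  + 1 / 2 * zeta 2 * (zeta (p + 1) + zeta_bar (p + 1))
  + 1 / 2 * zeta_star [Bar (p + 1); Plain 2]
  - sum_n_m (fun j => (1 - (-1) ^ (j - 1))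
                      * zeta_star [Bar j; Plain 1] * zeta (p + 2 - j)) 2 p
  - sum_n_m (fun j => zeta_star [Plain j; Bar 1] * zeta_bar (p + 2 - j))
            2 (p + 1)
  + (INR p + 2 + (-1) ^ (p - 1)) * zeta_star [Bar (p + 2); Plain 1]
  - zeta_star [Plain (p + 2); Bar 1]
  - sum_n_m (fun i => (-1) ^ (i - 1) * zeta (p + 1 - i) * zeta_bar (i + 2))
            1 (p - 1)
  - (INR p + 1) * zeta_star [Bar (p + 2); Bar 1]
  + ln 2 * zeta_star [Bar (p + 1); Bar 1].
Proof.
  intros p Hp. destruct p as [|k]; [lia|].
  replace (S k - 1)%nat with k by lia.
  replace (S k + 1)%nat with (k + 2)%nat by lia.
  replace (S k + 2)%nat with (k + 3)%nat by lia.
  rewrite (Series1_ext (fun n => L n 1 ^ 2 / INR n ^ (k + 2) * (-1) ^ (n - 1))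
             (fun n => sg n * L n 1 ^ 2 / INR n ^ (k + 2)))
    by (intros; rewrite pow_m1_pred by easy; unfold Rdiv; ring).
  rewrite (Series1_ext (fun n => H n ^ 2 / INR n ^ (k + 2) * (-1) ^ (n - 1))
             (fun n => sg n * H n ^ 2 / INR n ^ (k + 2)))
    by (intros; rewrite pow_m1_pred by easy; unfold Rdiv; ring).
  fold (Dir (fun n => sg n * L n 1 ^ 2) (k + 2)).
  fold (Dir (fun n => sg n * H n ^ 2) (k + 2)).
  rewrite !zeta_Dir, zeta_bar_Dir, !zeta_star_Bar_Bar_1, !zeta_star_Bar_Plain_1,
    zeta_star_Bar_Plain_2, zeta_star_Plain_Bar_1.
  rewrite (sum_n_m_from_2 _ (S k) k eq_refl), sum_n_m_psum.
  (* The last index j = p + 1 carries the alternating zeta value at 1, which is ln 2, and is split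
     off. *)
  replace (sum_n_m (fun j => zeta_star [Plain j; Bar 1] * zeta_bar (k + 3 - j)) 2 (k + 2))
    with (- psum (fun i => Dir (fun n => L n 1) (S i) * Dir sg (k + 2 - i)) k
          - Dir (fun n => L n 1) (k + 2) * ln 2).
  2: { rewrite (sum_n_m_from_2 _ (k + 2) (S k)) by lia. cbn [psum].
       rewrite zeta_star_Plain_Bar_1, zeta_bar_Dir.
       replace (k + 3 - S (S k))%nat with 1%nat by lia. rewrite Dir_sg_1.
       replace (S (S k)) with (k + 2)%nat by lia.
       rewrite (psum_ext (fun i => zeta_star [Plain (S i); Bar 1] * zeta_bar (k + 3 - S i))
         (fun i => -1 * (Dir (fun n => L n 1) (S i) * Dir sg (k + 2 - i)))).
       - rewrite psum_scal. ring.
       - intros i Hi. rewrite zeta_star_Plain_Bar_1, zeta_bar_Dir.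
         replace (k + 3 - S i)%nat with (k + 2 - i)%nat by lia. ring. }
  rewrite (psum_ext (fun i => (1 - (-1) ^ (S i - 1)) * zeta_star [Bar (S i); Plain 1]
                               * zeta (k + 3 - S i))
    (fun i => -1 * ((1 - (-1) ^ i) * Dir (fun n => sg n * H n) (S i)
                      * Dir (fun _ => 1) (k + 2 - i)))), psum_scal.
  2: { intros i Hi. rewrite zeta_star_Bar_Plain_1, zeta_Dir.
       replace (k + 3 - S i)%nat with (k + 2 - i)%nat by lia.
       replace (S i - 1)%nat with i by lia. ring. }
  rewrite (psum_ext (fun i => (-1) ^ (i - 1) * zeta (k + 2 - i) * zeta_bar (i + 2))
    (fun i => (-1) ^ S i * Dir sg (S (S i)) * Dir (fun _ => 1) (k + 3 - S i))).
  2: { intros i Hi. rewrite zeta_Dir, zeta_bar_Dir, pow_m1_pred by lia. unfold sg at 1.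
       replace (k + 3 - S i)%nat with (k + 2 - i)%nat by lia.
       replace (i + 2)%nat with (S (S i)) by lia. ring. }
  pose proof (alternating_square_relation k) as R1.
  pose proof (quadratic_relation k) as R2.
  pose proof (linear_relation k) as R3.
  (* The first product is the alternating zeta value at 2 times zeta (p + 1). As the former is zeta
     2 / 2, this is one half of the zeta 2 term of the claim; [R2] holds the other. *)
  rewrite psum_first in R3.
  replace (k + 3 - 1)%nat with (k + 2)%nat in R3 by lia.
  replace ((-1) ^ (k + 3)) with (- (-1) ^ k) in R3
    by (rewrite pow_add; simpl; ring).
  rewrite Dir_sg_2 in R2, R3.
  rewrite plus_INR in R1, R2. rewrite S_INR. simpl (INR 2) in *.
  (* The claim is the sum of [R1] and [R2], with the left side of [R3] replaced by its right side.
     The L_n(2) series cancel, and the coefficients 1/2 and -1 of H_n(2) combine to -1/2. *)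
  lra.
Qed.
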